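(* Suppose that the heat flow $P_t$ is given by integration against a continuous kernel $p(t,x,y)$, i.e. $P_tf(x)=\int_X p(t,x,y)f(y)\,d\mu(y)$, satisfying $$p(t,x,y)\le \frac{\gamma_1}{t^{\alpha/\beta}}\exp\Bigl(-\gamma_2\Bigl(\frac{\operatorname{dist}(x,y)^{\beta}}{t}\Bigr)^{1/(\beta-1)}\Bigr)$$ for constants $\gamma_1,\gamma_2,\alpha>0$ and $\beta>1$. If $\mu(X)<\infty$, then for any compact set $K\subset X$ and any neighborhood $U$ of $K$, there is a smooth non-negative function that is $1$ on $K$ and vanishes outside $U$.
   Context: $(X,\operatorname{dist})$ is a metric space with a Borel measure $\mu$ and a self-adjoint Neumann Laplacian $\Delta$ on $L^2(X,\mu)$, associated to a Dirichlet form. ''Neumann'' means that no boundary condition is imposed; in particular, when $\mu(X)<\infty$ the constant function $1$ satisfies $\Delta1=0$, so $P_t1=1$. The sign convention is that $\Delta$ is non-negative and the heat operator at time $t$ is $P_t=e^{-t\Delta}=\int_0^\infty e^{-xt}\,dE_\Delta(x)$, where $E_\Delta$ is the spectral resolution of $\Delta$; $P_t$ is Markov ($0\le u\le 1$ a.e. implies $0\le P_tu\le1$ a.e.). The following two standing assumptions are made. (1) Spectral gap: there is $\lambda>0$ such that the spectrum of $\Delta$ is contained in $\{0\}\cup[\lambda,\infty)$. (2) For $t,d>0$ let $$D(t,d)^2=\sup\Bigl\{\int_L|P_tf|^2\,d\mu:\ \|f\|_2^2=1,\ L\subset X,\ \operatorname{dist}(\operatorname{supp}(f),L)\ge d\Bigr\}.$$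 There is $\epsilon_0>0$ such that for every $0<\epsilon<\epsilon_0$ there is a decreasing sequence $t_j>0$ with all $t_j<2/\lambda$ and $\sum_j t_j<\infty$, such that for every non-negative integer $k$, $\sum_{j=1}^\infty t_{j+1}^{-k}D(t_j,\epsilon2^{-j})<\infty$. A function $v$ is smooth if $\Delta^kv$ is defined and continuous, $\Delta^k v\in C(X)$, for every $k\ge0$. *)

(* Defs.v *)
From HB Require Import structures.
From mathcomp Require Import all_boot all_order all_algebra.
From mathcomp Require Import all_classical all_reals all_analysis.

Set Implicit Arguments.
Unset Strict Implicit.
Unset Printing Implicit Defensive.

Import Order.TTheory GRing.Theory Num.Theory.
Import numFieldNormedType.Exports.

Local Open Scope classical_set_scope.
Local Open Scope ring_scope.

(* The library's measurable types are pointed, hence a nonempty metric space. *)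
#[short(type="pmetricType")]
HB.structure Definition PointedMetric (K : numDomainType) :=
  {M of Pointed M & Metric K M}.

(* X with its Borel sigma-algebra; convertible to X *)
Notation borel X := (g_sigma_algebraType (@open X)).

Section RealHilbertSpaceL2.
Context {d : measure_display} {T : measurableType d} {R : realType}.
Variable mu : {measure set T -> \bar R}.

(* Square-integrable real functions. They form an lmodType, unlike the
   library's quotient Lspace, so an element of L^2(mu) is represented by a
   function, equality in L^2(mu) is [u = v %[ae mu]], and everything below is
   compatible with it. *)
Local Notation L2 := (LfunType mu (lee1n 2)).

Definition dot (u v : L2) : R := \int[mu]_x (u x * v x).
Definition norm2 (u : L2) : R := Num.sqrt (dot u u).

(* An unbounded operator is given by its graph: [A u w] means that u is in the
   domain of A and that A u = w. *)
Definition operator := L2 -> L2 -> Prop.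

Definition domain (A : operator) : set L2 := [set u | exists w, A u w].

Definition dense_in_L2 (F : set L2) :=
  forall (u : L2) (e : R), 0 < e -> exists2 v, F v & norm2 (u - v) < e.

Record linear_operator (A : operator) : Prop := {
  operator_ae : forall u u' w w' : L2,
    u = u' %[ae mu] -> w = w' %[ae mu] -> A u w -> A u' w' ;
  operator_fun : forall u w w' : L2, A u w -> A u w' -> w = w' %[ae mu] ;
  operator0 : A 0 0 ;
  operator_lin : forall (a : R) (u v w z : L2),
    A u w -> A v z -> A (a *: u + v) (a *: w + z) }.

Definition adjoint (A : operator) : operator :=
  fun u w => forall v z, A v z -> dot z u = dot v w.

Definition self_adjoint (A : operator) : Prop :=
  [/\ linear_operator A, dense_in_L2 (domain A)
    & forall u w, A u w <-> adjoint A u w].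

Fixpoint iter_operator (A : operator) (k : nat) : operator :=
  if k is k'.+1 then fun u w => exists2 z, iter_operator A k' u z & A z w
  else fun u w => u = w %[ae mu].

Definition bounded_operator (B : L2 -> L2) : Prop :=
  (forall (a : R) (u v : L2), B (a *: u + v) = a *: B u + B v %[ae mu]) /\
  (exists C : R, forall u, norm2 (B u) <= C * norm2 u).

(* Real points of the resolvent set: A - z maps its domain bijectively onto L^2
   with bounded inverse B. Only self-adjoint operators are considered, whose
   spectrum on the complexified space is real, so nothing is lost. *)
Definition resolvent_set (A : operator) : set R :=
  [set z | exists B : L2 -> L2, [/\ bounded_operator B,
     forall u, A (B u) (u + z *: B u)
   & forall u w, A u w -> B (w - z *: u) = u %[ae mu]]].

Definition spectrum (A : operator) : set R := ~` resolvent_set A.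

Record dirichlet_form (F : set L2) (E : L2 -> L2 -> R) : Prop := {
  form_ae : forall u u' v : L2, u = u' %[ae mu] -> F u ->
    F u' /\ (F v -> E u v = E u' v) ;
  form_domain0 : F 0 ;
  form_domain_lin : forall (a : R) (u v : L2), F u -> F v -> F (a *: u + v) ;
  form_dense : dense_in_L2 F ;
  form_lin : forall (a : R) (u v w : L2), F u -> F v -> F w ->
    E (a *: u + v) w = a * E u w + E v w ;
  form_sym : forall u v, F u -> F v -> E u v = E v u ;
  form_ge0 : forall u, F u -> 0 <= E u u ;
  (* closedness: F is complete for the norm E(u,u) + ||u||^2 *)
  form_closed : let E1 w := E w w + dot w w in
    forall u : nat -> L2, (forall n, F (u n)) ->
    (forall e : R, 0 < e -> exists N, forall m n,
       (N <= m)%N -> (N <= n)%N -> E1 (u m - u n) < e) ->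
    exists2 v, F v & (fun n => E1 (u n - v)) @ \oo --> (0 : R) ;
  (* the unit contraction operates *)
  form_markov : forall u v : L2, F u ->
    v = (fun x => Num.min (Num.max (u x) 0) 1) %[ae mu] ->
    F v /\ E v v <= E u u }.

(* A is the (non-negative) operator associated to the form: E(u,v) = <A u,v>. *)
Definition associated_operator (F : set L2) (E : L2 -> L2 -> R)
    (A : operator) : Prop :=
  forall u w, A u w <-> F u /\ forall v, F v -> E u v = dot w v.

(* A projection-valued measure; [pvm_measure u] is the measure <E(B)u,u>. *)
Record proj_measure := {
  pvm : set R -> L2 -> L2 ;
  pvm_measure : L2 -> {measure set (measurableTypeR R) -> \bar R} ;
  pvm_bounded : forall B : set (measurableTypeR R), measurable B ->
    bounded_operator (pvm B) ;
  pvm_sym : forall B : set (measurableTypeR R), measurable B ->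
    forall u v, dot (pvm B u) v = dot u (pvm B v) ;
  pvmT : forall u, pvm setT u = u %[ae mu] ;
  pvmI : forall B C : set (measurableTypeR R), measurable B -> measurable C ->
    forall u, pvm (B `&` C) u = pvm B (pvm C u) %[ae mu] ;
  pvm_measureE : forall B : set (measurableTypeR R), measurable B ->
    forall u, pvm_measure u B = (dot (pvm B u) u)%:E }.

(* The operator \int_D phi(x) dE(x) for Borel phi. Its domain is the set of the
   u with \int_D phi(x)^2 d<E(x)u,u> finite; its value at u is tested against
   the v in this dense domain, the integral for d<E(x)u,v> being given by
   polarization. *)
Definition spectral_integral (E : proj_measure) (D : set R) (phi : R -> R) :
    operator := fun u w =>
  let dom := [set v | (\int[pvm_measure E v]_(x in D) (phi x ^+ 2)%:E < +oo)%E]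
  in dom u /\ forall v, dom v ->
    dot w v = (\int[pvm_measure E (u + v)%R]_(x in D) phi x
             - \int[pvm_measure E (u - v)%R]_(x in D) phi x) / 4%:R.

Definition spectral_resolution (A : operator) (E : proj_measure) : Prop :=
  forall u w, A u w <-> spectral_integral E setT (fun x => x) u w.

(* P_t = \int_0^oo e^(-xt) dE(x) *)
Definition heat_operators (E : proj_measure) (P : R -> L2 -> L2) : Prop :=
  forall (t : R) (u : L2), 0 < t ->
    spectral_integral E `[0, +oo[%classic (fun x => expR (- (x * t))) u (P t u).

Definition markov_operators (P : R -> L2 -> L2) : Prop :=
  forall (t : R) (u : L2), 0 < t ->
    {ae mu, forall x, 0 <= u x <= 1} -> {ae mu, forall x, 0 <= P t u x <= 1}.

(* No boundary condition: 1 is in the domain, with image 0, if mu is finite. *)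
Definition neumann (A : operator) : Prop :=
  (mu setT < +oo)%E -> forall u : L2, u = cst 1 %[ae mu] -> A u 0.

End RealHilbertSpaceL2.

Notation L2 mu := (LfunType mu (lee1n 2)).

Section HeatFlow.
Context {R : realType} {X : pmetricType R}.
Variable mu : {measure set (borel X) -> \bar R}.

(* The closed support of the measure |f| mu *)
Definition ess_support (f : L2 mu) : set X :=
  [set x | ~ exists U : set X,
     [/\ open U, U x & {ae mu, forall y, U y -> f y = 0}]].

(* dist(A, B) >= d, with dist = +oo if A or B is empty *)
Definition dist_ge (A B : set X) (d : R) : Prop :=
  forall x y, A x -> B y -> d <= mdist x y.

(* D(t,d). The set is bounded, as P_t is a contraction, and its real supremum
   is by convention 0 if L^2 = 0. *)
Definition heat_decay (P : R -> L2 mu -> L2 mu) (t d : R) : R :=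
  Num.sqrt (sup [set r | exists (f : L2 mu) (L : set (borel X)),
    [/\ norm2 f ^+ 2 = 1, measurable L, dist_ge (ess_support f) L d
      & r = \int[mu]_(x in L) (P t f x) ^+ 2]]).

(* The sequence is t_1, t_2, ...; the value at 0 is irrelevant. *)
Definition decay_assumption (P : R -> L2 mu -> L2 mu) (lambda : R) : Prop :=
  exists2 eps0 : R, 0 < eps0 & forall eps : R, 0 < eps < eps0 ->
  exists t : nat -> R,
  [/\ forall j, (1 <= j)%N -> t j.+1 <= t j,
      forall j, (1 <= j)%N -> 0 < t j < 2 / lambda,
      (\sum_(1 <= j <oo) (t j)%:E < +oo)%E
    & forall k : nat,
      (\sum_(1 <= j <oo)
         ((t j.+1) ^- k * heat_decay P (t j) (eps * 2 ^- j))%:E < +oo)%E].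

(* P_t is integration against p(t,.,.), continuous on X * X *)
Definition continuous_heat_kernel (P : R -> L2 mu -> L2 mu)
    (p : R -> X -> X -> R) : Prop :=
  forall t : R, 0 < t ->
    continuous (fun z : X * X => p t z.1 z.2) /\
    forall f : L2 mu, {ae mu, forall x,
      mu.-integrable setT (fun y => (p t x y * f y)%:E) /\
      P t f x = \int[mu]_y (p t x y * f y)}.

(* v is continuous, square integrable and in the domain of each A^k, and each
   A^k v has a continuous representative. *)
Definition smooth (A : operator mu) (v : X -> R) : Prop :=
  continuous v /\
  exists2 u : L2 mu, (u : X -> R) = v & forall k : nat,
    exists2 w : L2 mu, iter_operator A k u w & continuous (w : X -> R).

End HeatFlow.

(* Main.v *)
Require Import Defs.
From mathcomp Require Import all_boot all_order all_algebra.
From mathcomp Require Import all_classical all_reals all_analysis.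
From mathcomp Require Import measurable_realfun ring lra.

Set Implicit Arguments.
Unset Strict Implicit.
Unset Printing Implicit Defensive.

Import Order.TTheory GRing.Theory Num.Theory.
Import numFieldNormedType.Exports.

Local Open Scope classical_set_scope.
Local Open Scope ring_scope.

(** The heat flow makes functions smooth but spreads their support; a cut-off
    restores the support but destroys smoothness. The two are alternated, with
    heat flow for times a_0, a_1, a_2, ... of finite sum, in such a way that the
    cut-offs are too small to harm.

    Let [delta] be a 1-Lipschitz function that is at most 0 on K and at least r
    off U ([lipschitz_separation]), and f_0 the indicator of [delta <= r / 2].
    From f_n one forms P_(a_n) f_n and resets it to 1 and to 0 at a distance d_n
    from where f_n was not 1 and not 0, the distances having sum at most r / 4.
    Where it resets to 0, the error e_n is controlled by D(a_n, d_n) by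
    definition; where it resets to 1 the same holds, because P_t 1 = 1 when the
    measure is finite ([cutoff_step]). If s_n is the sum of the times a_n,
    a_(n+1), ..., then P_(s_n) f_n is the sum of P_(s_0) f_0 and of the
    P_(s_(j+1)) e_j for j < n. The k-th power of the generator multiplies the
    norm of the j-th term by at most a constant times the k-th power of
    1 / s_(j+1), hence of 1 / a_(j+1), and the hypothesis on D says exactly that
    these series converge for every k ([smooth_heat_series], [cutoff_limit]).

    Continuity comes from the kernel: the power of t bounding it makes P_t
    bounded from L^2 to continuous bounded functions, with a norm that is again a
    power of 1 / t. Spending half of each time in this way turns all
    convergences in L^2 into uniform ones ([heat_smoothing]). Even the existence
    of the generator applied to P_t u is obtained so, as a uniform limit of
    difference quotients ([heat_domain]). The limit of P_(s_n) f_n is 1 on K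
    and 0 off U, because s_n tends to 0 and the kernel then vanishes at
    positive distance.

    The properties of the flow come from a calculus of the bounded functions of
    the resolution of the identity, proved on indicators and extended to bounded
    Borel functions by linearity and boundedness ([functional_calculus_form],
    [operator_functional_calculus], [heat_fixed]).

    The kernel is tied to the flow almost everywhere only. As P_t 1 = 1 and the
    kernel vanishes off the diagonal for small t, almost every point belongs to
    the support of the measure ([ae_support]). On the support, positivity of the
    flow gives positivity of the kernel ([kernel_ge0]), and all relations hold at
    every point. Elsewhere the function obtained is corrected by Tietze's theorem
    ([support_extension]). *)

(** * Square-integrable functions *)

Section SquareIntegrable.
Context {d : measure_display} {T : measurableType d} {R : realType}.
Context {mu : {measure set T -> \bar R}}.
Implicit Types u v w : L2 mu.

Lemma L2_measurable u : measurable_fun setT (u : T -> R).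
Proof. by have /andP[] := LfunP u; rewrite inE. Qed.

Lemma dot_integrable u v : mu.-integrable setT (EFin \o (fun x => u x * v x)).
Proof. exact/Lfun1_integrable/Lfun2_mul_Lfun1/LfunP/LfunP. Qed.

Lemma dotC u v : dot u v = dot v u.
Proof. by apply: eq_Rintegral => x _; rewrite mulrC. Qed.

Lemma dot_linl a u v w : dot (a *: u + v) w = a * dot u w + dot v w.
Proof.
rewrite /dot -RintegralZl//; last exact: dot_integrable.
rewrite -RintegralD//; last 2 first.
- exact: (integrableZl measurableT a (dot_integrable u w)).
- exact: dot_integrable.
by apply: eq_Rintegral => x _; rewrite mulrDl mulrA.
Qed.

Lemma dot_linr a u v w : dot w (a *: u + v) = a * dot w u + dot w v.
Proof. by rewrite dotC dot_linl !(dotC w). Qed.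

Lemma dotDl u v w : dot (u + v) w = dot u w + dot v w.
Proof. by have := dot_linl 1 u v w; rewrite scale1r mul1r. Qed.

Lemma dotDr u v w : dot w (u + v) = dot w u + dot w v.
Proof. by rewrite dotC dotDl !(dotC w). Qed.

Lemma dot0l u : dot 0 u = 0.
Proof. by have := dotDl 0 0 u; rewrite addr0 => ?; lra. Qed.

Lemma dotZl a u w : dot (a *: u) w = a * dot u w.
Proof. by rewrite -[a *: u]addr0 dot_linl dot0l addr0. Qed.

Lemma dotZr a u w : dot w (a *: u) = a * dot w u.
Proof. by rewrite dotC dotZl dotC. Qed.

Lemma dotNl u w : dot (- u) w = - dot u w.
Proof. by rewrite -scaleN1r dotZl mulN1r. Qed.

Lemma dotNr u w : dot w (- u) = - dot w u.
Proof. by rewrite dotC dotNl dotC. Qed.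

Lemma dotBl u v w : dot (u - v) w = dot u w - dot v w.
Proof. by rewrite dotDl dotNl. Qed.

Lemma dotBr u v w : dot w (u - v) = dot w u - dot w v.
Proof. by rewrite dotDr dotNr. Qed.

Lemma dot_ge0 u : 0 <= dot u u.
Proof. by apply: Rintegral_ge0 => x _; rewrite -expr2 sqr_ge0. Qed.

Lemma norm2_ge0 u : 0 <= norm2 u. Proof. exact: sqrtr_ge0. Qed.

Lemma norm2_sqr u : norm2 u ^+ 2 = dot u u.
Proof. by rewrite sqr_sqrtr// dot_ge0. Qed.

Lemma norm2_le u (C : R) : 0 <= C -> dot u u <= C ^+ 2 -> norm2 u <= C.
Proof. by move=> C0 uC; rewrite -(ger0_norm C0) -sqrtr_sqr ler_wsqrtr. Qed.

Lemma cauchy_schwarz u v : `|dot u v| <= norm2 u * norm2 v.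
Proof.
rewrite -(ger0_norm (mulr_ge0 (norm2_ge0 u) (norm2_ge0 v))).
rewrite -ler_sqr ?nnegrE// -!normrX ?ger0_norm ?sqr_ge0//.
rewrite exprMn !norm2_sqr.
have := dot_ge0 (dot v v *: u - dot u v *: v).
rewrite dotBl !dotBr !dotZl !dotZr (dotC v u) => h.
have := dot_ge0 v; rewrite le_eqVlt => /predU1P[v0|v0]; last first.
  have : 0 <= dot v v * (dot u u * dot v v - dot u v ^+ 2) by nra.
  by rewrite pmulr_rge0// subr_ge0.
rewrite -v0 mulr0; suff -> : dot u v = 0 by rewrite expr0n.
(* when <v,v> = 0 the form is nonnegative along the whole line u + R v *)
have := dot_ge0 (u - ((dot u u + 1) / (2 * dot u v)) *: v).
rewrite dotBl !dotBr !dotZl !dotZr (dotC v u) -v0.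
have [//|uv0] := eqVneq (dot u v) 0.
set q := _ / _; have : q * (2 * dot u v) = dot u u + 1.
  by rewrite divfK// mulf_neq0.
by move=> *; nra.
Qed.

Lemma ler_norm2D u v : norm2 (u + v) <= norm2 u + norm2 v.
Proof.
apply: norm2_le; first by rewrite addr_ge0 ?norm2_ge0.
rewrite dotDl !dotDr (dotC v u) sqrrD !norm2_sqr.
have := cauchy_schwarz u v; rewrite ler_norml => /andP[_]; lra.
Qed.

Lemma norm2Z a u : norm2 (a *: u) = `|a| * norm2 u.
Proof.
by rewrite /norm2 dotZl dotZr mulrA -expr2 sqrtrM ?sqr_ge0// sqrtr_sqr.
Qed.

Lemma norm2N u : norm2 (- u) = norm2 u.
Proof. by rewrite -scaleN1r norm2Z normrN1 mul1r. Qed.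

Lemma dot_ae u u' v v' : u = u' %[ae mu] -> v = v' %[ae mu] ->
  dot u v = dot u' v'.
Proof.
move=> uu' vv'; congr fine; apply: ae_eq_integral => //.
- exact: measurable_int (dot_integrable u v).
- exact: measurable_int (dot_integrable u' v').
- by move: uu' vv'; apply: filterS2 => x /= -> // ->.
Qed.

Lemma norm2_ae u u' : u = u' %[ae mu] -> norm2 u = norm2 u'.
Proof. by move=> uu'; rewrite /norm2 (dot_ae uu' uu'). Qed.

Lemma dot_self_eq0 u : dot u u = 0 -> u = 0 %[ae mu].
Proof.
move=> uu; have iu := dot_integrable u u.
have : (\int[mu]_x `|(u x * u x)%:E| = 0)%E.
  under eq_integral do rewrite gee0_abs ?lee_fin -?expr2 ?sqr_ge0//.
  under eq_integral do rewrite expr2.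
  by rewrite -(fineK (integrable_fin_num measurableT iu)) -[fine _]/(dot u u) uu.
move/(ae_eq_integral_abs mu measurableT (measurable_int _ iu)).
by apply: filterS => x /= h _; have [/eqP] := h I; rewrite mulf_eq0 orbb => /eqP.
Qed.

Lemma ae_eq_sub0 u v : u - v = 0 %[ae mu] -> u = v %[ae mu].
Proof.
by apply: filterS => x /= h xT; apply/eqP; rewrite -subr_eq0; apply/eqP/h.
Qed.

(** Elements of L^2 are identified through their pairings; every operator
    identity below is established in this weak form. *)
Lemma dot_ext u u' : (forall v, dot u v = dot u' v) -> u = u' %[ae mu].
Proof.
by move=> e; apply/ae_eq_sub0/dot_self_eq0; rewrite dotBl e subrr.
Qed.

Lemma aeD u u' v v' : u = u' %[ae mu] -> v = v' %[ae mu] ->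
  u + v = u' + v' %[ae mu].
Proof.
move=> uu vv; apply: dot_ext => w.
by rewrite !dotDl (dot_ae uu (ae_eq_refl _ _ _)) (dot_ae vv (ae_eq_refl _ _ _)).
Qed.

Definition cvg2 (u_ : nat -> L2 mu) u := (fun n => norm2 (u_ n - u)) @ \oo --> 0.

Lemma cvg2_dot (u_ : nat -> L2 mu) u v :
  cvg2 u_ u -> (fun n => dot (u_ n) v) @ \oo --> dot u v.
Proof.
move=> uu; apply/cvgrPdist_le => e e0.
have d0 : 0 < e / (norm2 v + 1) by rewrite divr_gt0// ltr_wpDl// norm2_ge0.
move/cvgr0Pnorm_le : uu => /(_ _ d0); apply: filterS => n /=.
rewrite ger0_norm ?norm2_ge0// => h.
rewrite distrC -dotBl (le_trans (cauchy_schwarz _ _))//.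
rewrite (le_trans (ler_wpM2r (norm2_ge0 v) h))// -mulrA ler_piMr ?(ltW e0)//.
by rewrite mulrC ler_pdivrMr ?mul1r ?lerDl// ltr_wpDl// norm2_ge0.
Qed.

End SquareIntegrable.

(** * Functional calculus of a projection-valued measure *)

Section SpectralCalculus.
Context {d : measure_display} {T : measurableType d} {R : realType}.
Context {mu : {measure set T -> \bar R}}.
Context (E : proj_measure mu).
Implicit Types (u v w y : L2 mu) (phi psi rho : R -> R).

Definition bounded_borel psi :=
  measurable_fun setT psi /\ exists C, forall x, `|psi x| <= C.

Lemma bounded_borel_indic (B : set (measurableTypeR R)) :
  measurable B -> bounded_borel \1_B.
Proof.
move=> mB; split; first exact/measurable_indicP.
by exists 1 => x; rewrite indicE; case: (_ \in _); rewrite ?normr1 ?normr0.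
Qed.

Lemma bounded_borelM psi rho : bounded_borel psi -> bounded_borel rho ->
  bounded_borel (fun x => psi x * rho x).
Proof.
move=> [m1 [C1 b1]] [m2 [C2 b2]]; split; first exact: measurable_funM.
by exists (C1 * C2) => x; rewrite normrM ler_pM.
Qed.

Lemma bounded_borel_lin a psi rho : bounded_borel psi -> bounded_borel rho ->
  bounded_borel (fun x => a * psi x + rho x).
Proof.
move=> [m1 [C1 b1]] [m2 [C2 b2]]; split.
  by apply: measurable_funD => //; exact: measurable_funM.
exists (`|a| * C1 + C2) => x; rewrite (le_trans (ler_normD _ _))// lerD//.
by rewrite normrM ler_wpM2l.
Qed.

Definition bounded_functional (J : (R -> R) -> R) :=
  (forall a psi rho, bounded_borel psi -> bounded_borel rho ->
     J (fun x => a * psi x + rho x) = a * J psi + J rho) /\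
  (exists C, forall psi M, bounded_borel psi -> (forall x, `|psi x| <= M) ->
     `|J psi| <= C * M).

Lemma bounded_functional_lin a (J J' : (R -> R) -> R) :
  bounded_functional J -> bounded_functional J' ->
  bounded_functional (fun psi => a * J psi + J' psi).
Proof.
move=> [l1 [C1 b1]] [l2 [C2 b2]]; split.
  by move=> c psi rho bpsi brho; rewrite l1// l2//; ring.
exists (`|a| * C1 + C2) => psi M bpsi bM; rewrite (le_trans (ler_normD _ _))//.
by rewrite mulrDl lerD ?b2// normrM -mulrA ler_wpM2l// b1.
Qed.

Lemma bounded_functionalM rho J : bounded_borel rho -> bounded_functional J ->
  bounded_functional (fun psi => J (fun x => rho x * psi x)).
Proof.
move=> brho [l1 [C1 b1]]; split.
  move=> a psi psi' bpsi bpsi'.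
  rewrite -l1; [|exact: bounded_borelM..].
  by congr J; apply/funext => x; ring.
have [_ [C hC]] := brho; exists (C1 * C) => psi M bpsi hM.
rewrite -mulrA; apply: b1; first exact: bounded_borelM.
by move=> x; rewrite normrM ler_pM.
Qed.

(** A nonnegative function below [M] differs from half of [M] times the
    indicator of the set where it is at least [M / 2] by a nonnegative function
    below [M / 2]. Hence a functional vanishing on indicators does not see the
    difference between the function and one arbitrarily small. *)
Lemma bounded_functional_eq0 J : bounded_functional J ->
  (forall B : set (measurableTypeR R), measurable B -> J \1_B = 0) ->
  forall psi, bounded_borel psi -> J psi = 0.
Proof.
move=> [Jl [C Jb]] J0.
have half n : forall M psi, bounded_borel psi ->
    (forall x, 0 <= psi x <= M) -> `|J psi| <= C * (M / 2 ^+ n).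
  elim: n => [|n ih] M psi bpsi psiM.
    rewrite expr0 divr1; apply: Jb => // x.
    by have /andP[p0 pM] := psiM x; rewrite ger0_norm.
  pose B := psi @^-1` `[M / 2, +oo[.
  have mB : measurable (B : set (measurableTypeR R)).
    by rewrite /B -[X in measurable X]setTI; apply: bpsi.1.
  have bB := bounded_borel_indic mB.
  pose psi' x := - (M / 2) * \1_B x + psi x.
  have <- : J psi' = J psi by rewrite Jl// J0// mulr0 add0r.
  rewrite exprS invfM (mulrA M); apply: ih; first exact: bounded_borel_lin.
  move=> x; rewrite /psi' indicE; have := psiM x.
  have [|] := boolP (x \in B); rewrite ?inE ?notin_setE /B /= in_itv/= ?andbT.
    by move=> *; lra.
  by move=> /negP; rewrite -ltNge => *; lra.
have pos psi M : bounded_borel psi -> (forall x, 0 <= psi x <= M) -> J psi = 0.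
  move=> bpsi psiM; apply/normr0_eq0/eqP; rewrite eq_le normr_ge0 andbT.
  have h1 : `|2^-1 : R| < 1 by rewrite ger0_norm ?invr_ge0// invf_lt1 ?ltr1n.
  apply: (cvgr_to_ge (cvg_geometric (C * M) h1)); apply: nearW => n.
  by rewrite /geometric /= -mulrA exprVn; exact: half psiM.
move=> psi bpsi; have [_ [M psiM]] := bpsi.
have b1 := bounded_borel_indic measurableT.
have : J (fun x => M * \1_setT x + psi x) = 0.
  apply: (pos _ (M + M)); first exact: bounded_borel_lin.
  by move=> x; rewrite indicT mulr1; have := psiM x; rewrite ler_norml; lra.
by rewrite Jl// J0// mulr0 add0r.
Qed.

(** The identities of the functional calculus are checked on indicators, where
    they are the axioms of a projection-valued measure. *)
Lemma bounded_functional_ext J J' :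
  bounded_functional J -> bounded_functional J' ->
  (forall B : set (measurableTypeR R), measurable B -> J \1_B = J' \1_B) ->
  forall psi, bounded_borel psi -> J psi = J' psi.
Proof.
move=> bJ bJ' JJ' psi bpsi; have b := bounded_functional_lin (-1) bJ' bJ.
apply/eqP; rewrite -subr_eq0 addrC -mulN1r; apply/eqP.
apply: (bounded_functional_eq0 b) => // B mB.
by rewrite JJ'// mulN1r addNr.
Qed.

Lemma pvm_measureT u : pvm_measure E u setT = (dot u u)%:E.
Proof.
by rewrite pvm_measureE// (dot_ae (pvmT E u) (ae_eq_refl _ _ _)).
Qed.

Lemma bounded_borel_integrable psi u : bounded_borel psi ->
  (pvm_measure E u).-integrable setT (EFin \o psi).
Proof.
move=> [mpsi [C hC]]; apply: measurable_bounded_integrable => //.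
  by rewrite pvm_measureT ltry.
exists C; split => [|x Cx y _]; first by rewrite num_real.
by apply: (le_trans (hC y)); exact: ltW.
Qed.

(** By polarization, the integral of [psi] against the signed measure
    <E(.)u,v>. *)
Definition spectral_form u v psi :=
  (\int[pvm_measure E (u + v)]_x psi x - \int[pvm_measure E (u - v)]_x psi x)
  / 4.

Lemma Rintegral_pvm_functional u :
  bounded_functional (fun psi => \int[pvm_measure E u]_x psi x).
Proof.
split=> [a psi rho bpsi brho|].
  rewrite -RintegralZl//; last exact: bounded_borel_integrable.
  rewrite -RintegralD//; last exact: bounded_borel_integrable.
  exact: (integrableZl measurableT a (bounded_borel_integrable u bpsi)).
exists (dot u u) => psi M bpsi psiM.
have ipsi := bounded_borel_integrable u bpsi.
rewrite (le_trans (le_normr_Rintegral _ ipsi))//.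
have -> : dot u u * M = \int[pvm_measure E u]_x M.
  by rewrite Rintegral_cst// pvm_measureT mulrC.
apply: le_Rintegral => //; first exact: (integrable_norm ipsi).
apply: (@bounded_borel_integrable (cst M)); split => //.
by exists `|M|.
Qed.

Lemma spectral_form_functional u v : bounded_functional (spectral_form u v).
Proof.
have [lp [Cp bp]] := Rintegral_pvm_functional (u + v).
have [lm [Cm bm]] := Rintegral_pvm_functional (u - v).
rewrite /spectral_form; split=> [a psi rho bpsi brho|].
  by rewrite lp// lm//; field.
exists ((Cp + Cm) / 4) => psi M bpsi psiM; rewrite normrM.
have -> : `|4^-1 : R| = 4^-1 by rewrite ger0_norm ?invr_ge0.
rewrite -mulrA (mulrC _ M) mulrA ler_wpM2r ?invr_ge0// mulrDl.
by rewrite (le_trans (ler_normB _ _))// lerD// ?bp ?bm.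
Qed.

Lemma Rintegral_pvm_indic (B : set (measurableTypeR R)) u : measurable B ->
  \int[pvm_measure E u]_x \1_B x = dot (pvm E B u) u.
Proof.
by move=> mB; rewrite /Rintegral integral_indic// setIT pvm_measureE.
Qed.

Lemma dot_pvm_linl (B : set (measurableTypeR R)) a u v w : measurable B ->
  dot (pvm E B (a *: u + v)) w = a * dot (pvm E B u) w + dot (pvm E B v) w.
Proof.
move=> mB; have [lB _] := pvm_bounded E mB.
by rewrite (dot_ae (lB a u v) (ae_eq_refl _ _ _)) dot_linl.
Qed.

Lemma spectral_form_indic (B : set (measurableTypeR R)) u v : measurable B ->
  spectral_form u v \1_B = dot (pvm E B u) v.
Proof.
move=> mB; rewrite /spectral_form !Rintegral_pvm_indic//.
have -> : u + v = 1 *: u + v by rewrite scale1r.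
have -> : u - v = - 1 *: v + u by rewrite scaleN1r addrC.
rewrite !dot_pvm_linl// !dot_linr (dotC (pvm E B v) u) -(pvm_sym E mB).
by field.
Qed.

Lemma spectral_form_linl a u v w psi : bounded_borel psi ->
  spectral_form (a *: u + v) w psi
  = a * spectral_form u w psi + spectral_form v w psi.
Proof.
apply: (bounded_functional_ext (spectral_form_functional _ _)
  (bounded_functional_lin a (spectral_form_functional _ _)
     (spectral_form_functional _ _))) => B mB.
by rewrite !spectral_form_indic// dot_pvm_linl.
Qed.

Lemma spectral_formC u v psi : bounded_borel psi ->
  spectral_form u v psi = spectral_form v u psi.
Proof.
apply: (bounded_functional_ext (spectral_form_functional _ _)
  (spectral_form_functional _ _)) => B mB.
by rewrite !spectral_form_indic// pvm_sym// dotC.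
Qed.

Lemma spectral_form_diag u psi : bounded_borel psi ->
  spectral_form u u psi = \int[pvm_measure E u]_x psi x.
Proof.
apply: (bounded_functional_ext (spectral_form_functional _ _)
  (Rintegral_pvm_functional _)) => B mB.
by rewrite spectral_form_indic// Rintegral_pvm_indic.
Qed.

Lemma spectral_form_pvm (B : set (measurableTypeR R)) u v psi : measurable B ->
  bounded_borel psi ->
  spectral_form (pvm E B u) v psi = spectral_form u v (fun x => \1_B x * psi x).
Proof.
move=> mB; apply: (bounded_functional_ext (spectral_form_functional _ _)
  (bounded_functionalM (bounded_borel_indic mB) (spectral_form_functional _ _))).
move=> C mC.
have -> : (fun x => \1_B x * \1_C x) = \1_(C `&` B) :> (R -> R).
  by apply/funext => x; rewrite mulrC indicI.
rewrite !spectral_form_indic//; last exact: measurableI.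
by rewrite (dot_ae (pvmI E mC mB u) (ae_eq_refl _ _ _)).
Qed.

(** The relation y = rho(E)u, tested weakly. The operator rho(E) itself is never
    constructed: the values needed below are produced by other means, and only
    have to be recognised. *)
Definition functional_calculus rho u y :=
  forall v, dot y v = spectral_form u v rho.

Lemma functional_calculus_pvm (B : set (measurableTypeR R)) u : measurable B ->
  functional_calculus \1_B u (pvm E B u).
Proof. by move=> mB v; rewrite spectral_form_indic. Qed.

Lemma functional_calculus_uniq rho u y y' : functional_calculus rho u y ->
  functional_calculus rho u y' -> y = y' %[ae mu].
Proof. by move=> h h'; apply: dot_ext => v; rewrite h h'. Qed.

(** The signed measure <E(.)y,v> of y = rho(E)u has density [rho] with respect
    to <E(.)u,v>. The multiplicativity of the calculus and all norm bounds
    follow. *)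
Lemma functional_calculus_form rho u y v psi : bounded_borel rho ->
  functional_calculus rho u y -> bounded_borel psi ->
  spectral_form y v psi = spectral_form u v (fun x => rho x * psi x).
Proof.
move=> brho uy; apply: (bounded_functional_ext (spectral_form_functional _ _)
  (bounded_functionalM brho (spectral_form_functional _ _))) => B mB.
rewrite spectral_form_indic// pvm_sym// uy spectral_formC//.
rewrite spectral_form_pvm// spectral_formC; last first.
  exact/bounded_borelM/brho/bounded_borel_indic.
by congr spectral_form; apply/funext => x; rewrite mulrC.
Qed.

Lemma functional_calculus_comp rho psi u y z :
  bounded_borel rho -> bounded_borel psi ->
  functional_calculus rho u y -> functional_calculus psi y z ->
  functional_calculus (fun x => rho x * psi x) u z.
Proof.
by move=> brho bpsi uy yz v; rewrite yz (functional_calculus_form _ brho uy).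
Qed.

Lemma functional_calculus_lin a rho psi u y z :
  bounded_borel rho -> bounded_borel psi ->
  functional_calculus rho u y -> functional_calculus psi u z ->
  functional_calculus (fun x => a * rho x + psi x) u (a *: y + z).
Proof.
move=> brho bpsi uy uz v; have [l _] := spectral_form_functional u v.
by rewrite l// dot_linl uy uz.
Qed.

Lemma functional_calculus_dot rho u y : bounded_borel rho ->
  functional_calculus rho u y ->
  dot y y = \int[pvm_measure E u]_x (rho x * rho x).
Proof.
move=> brho uy; have brr := bounded_borelM brho brho.
by rewrite uy spectral_formC// (functional_calculus_form _ brho uy)//
  spectral_form_diag.
Qed.

Lemma functional_calculus_norm rho u y (C : R) : bounded_borel rho ->
  functional_calculus rho u y -> 0 <= C -> (forall x, `|rho x| <= C) ->
  norm2 y <= C * norm2 u.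
Proof.
move=> brho uy C0 rhoC; apply: norm2_le; first by rewrite mulr_ge0 ?norm2_ge0.
rewrite (functional_calculus_dot brho uy) exprMn norm2_sqr.
have -> : C ^+ 2 * dot u u = \int[pvm_measure E u]_x (C ^+ 2).
  by rewrite Rintegral_cst// pvm_measureT.
apply: le_Rintegral => //; first exact/bounded_borel_integrable/bounded_borelM.
  apply: (@bounded_borel_integrable (cst (C ^+ 2))); split => //.
  by exists `|C ^+ 2|.
by move=> x _; have := rhoC x; rewrite ler_norml => /andP[? ?]; nra.
Qed.

End SpectralCalculus.

(** * The unbounded operator *)

Lemma Rintegral_dominated_cvg {d : measure_display} {T : measurableType d}
    {R : realType} (m : {measure set T -> \bar R}) (f_ : nat -> T -> R)
    (f g : T -> R) :
  (forall n, measurable_fun setT (f_ n)) -> measurable_fun setT f ->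
  m.-integrable setT (EFin \o g) -> (forall n x, `|f_ n x| <= g x) ->
  (forall x, (fun n => f_ n x) @ \oo --> f x) ->
  (fun n => \int[m]_x f_ n x) @ \oo --> \int[m]_x f x.
Proof.
move=> mf_ mf ig fg ff.
have [] := @dominated_convergence _ _ _ m setT measurableT
  (fun n => EFin \o f_ n) (EFin \o f) (EFin \o g).
- by move=> n; exact/measurable_EFinP.
- exact/measurable_EFinP.
- by apply: aeW => x _; apply: cvg_EFin; [exact: nearW|exact: ff].
- exact: ig.
- by apply: aeW => x n _; rewrite lee_fin.
move=> intf _ c; apply: fine_cvg.
rewrite (fineK (integrable_fin_num measurableT intf)); exact: c.
Qed.

Section UnboundedOperator.
Context {d : measure_display} {T : measurableType d} {R : realType}.
Context {mu : {measure set T -> \bar R}}.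
Context (E : proj_measure mu).
Implicit Types (u v w y z : L2 mu) (phi psi rho : R -> R).

(** The truncations of the identity function, through which the unbounded
    operator is reached from the bounded calculus. *)
Definition clip (n : nat) (x : R) : R := x * \1_(`[- n%:R, n%:R]%classic) x.

Lemma clip_le n x : `|clip n x| <= `|x|.
Proof.
rewrite /clip normrM ler_piMr// indicE.
by case: (_ \in _); rewrite ?normr1 ?normr0.
Qed.

Lemma clip_bounded_borel n : bounded_borel (clip n).
Proof.
split.
  by apply: measurable_funM => //; exact/measurable_indicP/measurable_itv.
exists n%:R => x; rewrite /clip indicE.
have [|_] := boolP (_ \in _); last by rewrite mulr0 normr0.
by rewrite inE/= in_itv/= mulr1 ler_norml.
Qed.

Lemma clip_near x : \forall n \near \oo, clip n x = x.
Proof.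
near=> n; rewrite /clip indicE mem_set ?mulr1//= in_itv/= -ler_norml.
near: n; exact: nbhs_infty_ger.
Unshelve. all: by end_near. Qed.

Lemma clip_cvg x : (fun n => clip n x) @ \oo --> x.
Proof.
by apply: cvg_near_cst; exact: clip_near.
Qed.

Lemma clip_sqr_nd x m n : (m <= n)%N ->
  clip m x * clip m x <= clip n x * clip n x.
Proof.
move=> mn; rewrite /clip !indicE.
have [|_] := boolP (_ \in `[- m%:R, _]%classic); last first.
  by rewrite mulr0 mul0r -expr2 sqr_ge0.
rewrite inE/= in_itv/= => /andP[xm mx].
have nm : m%:R <= n%:R :> R by rewrite ler_nat.
by rewrite mem_set//= in_itv/=; apply/andP; split; lra.
Qed.

Definition spectral_domain u :=
  (\int[pvm_measure E u]_x (x ^+ 2)%:E < +oo)%E.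

Lemma clip_sqr_bounded_borel n : bounded_borel (fun x => clip n x * clip n x).
Proof. exact/bounded_borelM/clip_bounded_borel/clip_bounded_borel. Qed.

Lemma spectral_domain_integrable u : spectral_domain u ->
  (pvm_measure E u).-integrable setT (EFin \o (fun x : R => x ^+ 2)).
Proof.
move=> du; apply/integrableP; split; first exact/measurable_EFinP/measurable_funX.
by under eq_integral do rewrite gee0_abs ?lee_fin ?sqr_ge0//.
Qed.

(** Stated with truncations, membership in the domain can be tested by the
    bounded calculus alone. *)
Lemma spectral_domainP u : spectral_domain u <->
  exists C, forall n, spectral_form E u u (fun x => clip n x * clip n x) <= C.
Proof.
have msq : measurable_fun setT (fun x : R => x ^+ 2).
  exact: measurable_funX.
split=> [du|[C uC]].
  have isq := spectral_domain_integrable du.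
  exists (\int[pvm_measure E u]_x (x ^+ 2)) => n.
  have bc := clip_sqr_bounded_borel n.
  rewrite spectral_form_diag//; apply: le_Rintegral => //.
    exact: (bounded_borel_integrable E u bc).
  move=> x _; rewrite -expr2 -[leLHS]ger0_norm ?sqr_ge0// normrX.
  by rewrite -[leRHS]ger0_norm ?sqr_ge0// normrX ler_pXn2r ?nnegrE// clip_le.
rewrite /spectral_domain.
have -> : (\int[pvm_measure E u]_x (x ^+ 2)%:E = \int[pvm_measure E u]_x
    (limn (fun n => (clip n x * clip n x)%:E)))%E.
  apply: eq_integral => x _; apply/esym/cvg_lim => //.
  apply: cvg_EFin; first exact: nearW.
  by rewrite expr2; apply: cvgM; exact: clip_cvg.
rewrite monotone_convergence//; last 3 first.
- by move=> n; apply/measurable_EFinP; exact: (clip_sqr_bounded_borel n).1.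
- by move=> n x _; rewrite lee_fin -expr2 sqr_ge0.
- by move=> x _ m n mn; rewrite lee_fin clip_sqr_nd.
apply: (@le_lt_trans _ _ C%:E); last exact: ltry.
apply: lime_le.
  apply: ereal_nondecreasing_is_cvgn => m n mn; apply: ge0_le_integral => //.
  - by move=> x _; rewrite lee_fin -expr2 sqr_ge0.
  - apply/measurable_EFinP; exact: (clip_sqr_bounded_borel m).1.
  - apply/measurable_EFinP; exact: (clip_sqr_bounded_borel n).1.
  - by move=> x _; rewrite lee_fin clip_sqr_nd.
apply: nearW => n; have bc := clip_sqr_bounded_borel n.
have := uC n; rewrite spectral_form_diag// /Rintegral -lee_fin fineK//.
apply: integrable_fin_num => //; exact: (bounded_borel_integrable E u bc).
Qed.

Lemma spectral_formDl u v w psi : bounded_borel psi ->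
  spectral_form E (u + v) w psi
  = spectral_form E u w psi + spectral_form E v w psi.
Proof.
by move=> bpsi; have := spectral_form_linl E 1 u v w bpsi;
  rewrite scale1r mul1r.
Qed.

Lemma spectral_formNl u w psi : bounded_borel psi ->
  spectral_form E (- u) w psi = - spectral_form E u w psi.
Proof.
move=> bpsi; have := spectral_formDl (- u) u w bpsi.
have := spectral_formDl 0 0 w bpsi; rewrite addNr addr0 => *; lra.
Qed.

Lemma spectral_formDr u v w psi : bounded_borel psi ->
  spectral_form E w (u + v) psi
  = spectral_form E w u psi + spectral_form E w v psi.
Proof.
by move=> bpsi; rewrite spectral_formC// spectral_formDl// !(spectral_formC E w).
Qed.

Lemma spectral_formNr u w psi : bounded_borel psi ->
  spectral_form E w (- u) psi = - spectral_form E w u psi.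
Proof.
by move=> bpsi; rewrite spectral_formC// spectral_formNl// (spectral_formC E w).
Qed.

(** By the parallelogram law for the measures <E(.)u,u>. *)
Lemma spectral_domainD u v : spectral_domain u -> spectral_domain v ->
  spectral_domain (u + v) /\ spectral_domain (u - v).
Proof.
move=> /spectral_domainP[C uC] /spectral_domainP[D vD].
have par n (q := fun u => spectral_form E u u (fun x => clip n x * clip n x)) :
    q (u + v) + q (u - v) = 2 * q u + 2 * q v.
  have bc := clip_sqr_bounded_borel n.
  rewrite /q !spectral_formDl// !spectral_formDr// !spectral_formNl//.
  by rewrite !spectral_formNr//; ring.
have q0 n w : 0 <= spectral_form E w w (fun x => clip n x * clip n x).
  rewrite spectral_form_diag; last exact: clip_sqr_bounded_borel.
  by apply: Rintegral_ge0 => x _; rewrite -expr2 sqr_ge0.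
split; apply/spectral_domainP; exists (2 * C + 2 * D) => n; have := par n;
  have := uC n; have := vD n; [have := q0 n (u - v)|have := q0 n (u + v)] => /=;
  move=> *; lra.
Qed.

Lemma spectral_form_cvg u v (rho_ : nat -> R -> R) rho (C : R) :
  (forall n, measurable_fun setT (rho_ n)) -> measurable_fun setT rho ->
  (forall n x, `|rho_ n x| <= C) ->
  (forall x, (fun n => rho_ n x) @ \oo --> rho x) ->
  (fun n => spectral_form E u v (rho_ n)) @ \oo --> spectral_form E u v rho.
Proof.
move=> mr_ mr rC rr.
have bC : bounded_borel (cst C : R -> R) by split => //; exists `|C|.
apply: cvgMl; apply: cvgB;
  by apply: (@Rintegral_dominated_cvg _ _ _ _ _ _ (cst C)) => //;
  exact: bounded_borel_integrable.
Qed.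

(** Dominated by 1 + x^2, which is integrable for vectors of the domain. *)
Lemma spectral_form_clip_cvg u v : spectral_domain u -> spectral_domain v ->
  (fun n => spectral_form E u v (clip n)) @ \oo --> spectral_form E u v id.
Proof.
move=> du dv; have [dp dm] := spectral_domainD du dv.
have ig w : spectral_domain w ->
    (pvm_measure E w).-integrable setT (EFin \o (fun x : R => 1 + x ^+ 2)).
  move=> dw; have i1 : (pvm_measure E w).-integrable setT (EFin \o cst (1 : R)).
    by apply: bounded_borel_integrable; split => //; exists `|1|.
  exact: (integrableD measurableT i1 (spectral_domain_integrable dw)).
have cg n x : `|clip n x| <= 1 + x ^+ 2.
  rewrite (le_trans (clip_le n x))// -real_normK ?num_real//.
  by have := sqr_ge0 (`|x| - 1); have := normr_ge0 x; nra.
have c w : spectral_domain w -> (fun n => \int[pvm_measure E w]_x clip n x) @ \oo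
    --> \int[pvm_measure E w]_x (x : R).
  move=> dw; apply: (Rintegral_dominated_cvg _ _ (ig w dw)) => //.
  - by move=> n; exact: (clip_bounded_borel n).1.
  - exact: clip_cvg.
by apply: cvgMl; apply: cvgB; exact: c.
Qed.

Context (A : operator mu) (AE : spectral_resolution A E).

Lemma spectral_operatorP u w : A u w <-> spectral_domain u /\
  forall v, spectral_domain v -> dot w v = spectral_form E u v id.
Proof. exact: AE. Qed.

(** Membership in the domain comes from the bound on x rho(x); the value is
    compared on truncations, where both sides are bounded forms. *)
Lemma operator_functional_calculus rho u y w : bounded_borel rho ->
  bounded_borel (fun x => x * rho x) ->
  functional_calculus E rho u y ->
  functional_calculus E (fun x => x * rho x) u w -> A y w.
Proof.
move=> brho bxrho uy uw; have [_ [C xrC]] := bxrho.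
have clipC n x : `|rho x * clip n x| <= C.
  apply: le_trans (xrC x); rewrite (normrM (rho x)) [leRHS]normrM mulrC.
  by apply: ler_wpM2r => //; exact: clip_le.
have C0 : 0 <= C by exact: le_trans (normr_ge0 _) (xrC 0).
have dy : spectral_domain y.
  apply/spectral_domainP; exists (C * C * dot u u) => n.
  have bc := clip_bounded_borel n; have bcc := clip_sqr_bounded_borel n.
  rewrite (functional_calculus_form _ brho uy)//.
  rewrite spectral_formC; last exact: bounded_borelM.
  rewrite (functional_calculus_form _ brho uy); last exact: bounded_borelM.
  have [brc brrcc] : bounded_borel (fun x => rho x * clip n x) /\
     bounded_borel (fun x => rho x * (rho x * (clip n x * clip n x))).
    by split; [|apply: bounded_borelM => //]; exact: bounded_borelM.
  rewrite spectral_form_diag//.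
  have -> : C * C * dot u u = \int[pvm_measure E u]_x (C * C).
    by rewrite Rintegral_cst// pvm_measureT.
  apply: le_Rintegral => //; first exact: bounded_borel_integrable.
    apply: (@bounded_borel_integrable _ _ _ _ _ (cst (C * C))).
    by split => //; exists `|C * C|.
  move=> x _; have := clipC n x; rewrite ler_norml => /andP[? ?].
  have -> : rho x * (rho x * (clip n x * clip n x))
    = (rho x * clip n x) * (rho x * clip n x) by ring.
  by nra.
apply/spectral_operatorP; split => // v dv; rewrite uw.
have c1 := spectral_form_clip_cvg dy dv.
have c2 : (fun n => spectral_form E u v (fun x => rho x * clip n x)) @ \oo -->
    spectral_form E u v (fun x => x * rho x).
  apply: (@spectral_form_cvg _ _ _ _ C) => //.
  - move=> n; exact: (bounded_borelM brho (clip_bounded_borel n)).1.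
  - exact: bxrho.1.
  - by move=> x; rewrite mulrC; apply: cvgMr; exact: clip_cvg.
apply: (cvg_unique _ c2) => //.
move: c1; apply: cvg_trans; apply: near_eq_cvg; apply: nearW => n.
exact/functional_calculus_form/clip_bounded_borel.
Qed.

(** Truncations are moved across the form by the bounded calculus, first from
    the right argument to the measure and then to the left argument. *)
Lemma operator_commute rho (S : L2 mu -> L2 mu) u w : bounded_borel rho ->
  (forall v, functional_calculus E rho v (S v)) -> A u w -> A (S u) (S w).
Proof.
move=> brho hS /spectral_operatorP[du uw].
have [_ [C rC]] := brho.
have C0 : 0 <= C by exact: le_trans (normr_ge0 _) (rC 0).
have dS v : spectral_domain v -> spectral_domain (S v).
  move=> /spectral_domainP[D vD]; apply/spectral_domainP.
  exists (C * C * D) => n; rewrite (le_trans _ (ler_wpM2l _ (vD n))) ?mulr_ge0//.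
  have bc := clip_bounded_borel n; have bcc := clip_sqr_bounded_borel n.
  rewrite (functional_calculus_form _ brho (hS v))//.
  rewrite spectral_formC; last exact: bounded_borelM.
  rewrite (functional_calculus_form _ brho (hS v)); last exact: bounded_borelM.
  have brrcc : bounded_borel (fun x => rho x * (rho x * (clip n x * clip n x))).
    by apply: bounded_borelM => //; exact: bounded_borelM.
  rewrite !spectral_form_diag// -RintegralZl//; last first.
    exact: bounded_borel_integrable.
  apply: le_Rintegral => //; first exact: bounded_borel_integrable.
    apply: (@bounded_borel_integrable _ _ _ _ _
      (fun x => C * C * (clip n x * clip n x))).
    by apply: (@bounded_borelM _ (cst (C * C))) => //; split => //;
      exists `|C * C|.
  move=> x _; have := rC x; rewrite ler_norml => /andP[? ?].
  have -> : rho x * (rho x * (clip n x * clip n x))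
    = (rho x * rho x) * (clip n x * clip n x) by ring.
  by rewrite ler_wpM2r -?expr2 ?sqr_ge0// !expr2; nra.
apply/spectral_operatorP; split; first exact: dS.
move=> v dv; have -> : dot (S w) v = dot w (S v).
  by rewrite hS spectral_formC// -hS dotC.
rewrite uw; last exact: dS.
apply: (cvg_unique _ (spectral_form_clip_cvg du (dS _ dv))) => //.
have := spectral_form_clip_cvg (dS _ du) dv.
apply: cvg_trans; apply: near_eq_cvg; apply: nearW => n.
have bc := clip_bounded_borel n.
rewrite (functional_calculus_form _ brho (hS u))// [RHS]spectral_formC//.
rewrite (functional_calculus_form _ brho (hS v))// spectral_formC//.
exact: bounded_borelM.
Qed.

End UnboundedOperator.

(** * The heat semigroup *)

Section HeatSemigroup.
Context {d : measure_display} {T : measurableType d} {R : realType}.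
Context {mu : {measure set T -> \bar R}}.
Context (A : operator mu) (E : proj_measure mu) (P : R -> L2 mu -> L2 mu).
Hypothesis saA : self_adjoint A.
Hypothesis AE : spectral_resolution A E.
Hypothesis PE : heat_operators E P.
Implicit Types (u v w y z : L2 mu) (s t h : R).

Definition heat_symbol t (x : R) : R :=
  expR (- (x * t)) * \1_(`[0, +oo[%classic) x.

Lemma heat_symbol_ge0 t x : 0 <= heat_symbol t x.
Proof. by rewrite mulr_ge0 ?expR_ge0. Qed.

Lemma heat_symbolE t x : 0 <= x -> heat_symbol t x = expR (- (x * t)).
Proof.
by move=> x0; rewrite /heat_symbol indicE mem_set ?mulr1//= in_itv/= andbT.
Qed.

Lemma heat_symbol_neg t x : x < 0 -> heat_symbol t x = 0.
Proof.
move=> x0; rewrite /heat_symbol indicE memNset ?mulr0//=.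
by rewrite in_itv/= andbT leNgt x0.
Qed.

Lemma heat_symbol_le1 t x : 0 < t -> `|heat_symbol t x| <= 1.
Proof.
move=> t0; rewrite ger0_norm ?heat_symbol_ge0//.
have [x0|x0] := leP 0 x; last by rewrite heat_symbol_neg.
by rewrite heat_symbolE// expR_le1 oppr_le0 mulr_ge0// ltW.
Qed.

Lemma heat_symbol_measurable t : measurable_fun setT (heat_symbol t).
Proof.
apply: measurable_funM; last by apply/measurable_indicP; exact: measurable_itv.
apply: (measurableT_comp (@measurable_expR R)).
by apply: measurable_funN; exact: measurable_funM.
Qed.

Lemma heat_symbol_bounded_borel t : 0 < t -> bounded_borel (heat_symbol t).
Proof.
move=> t0; split; first exact: heat_symbol_measurable.
by exists 1 => x; exact: heat_symbol_le1.
Qed.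

Lemma heat_symbolD s t x :
  heat_symbol s x * heat_symbol t x = heat_symbol (s + t) x.
Proof.
have [x0|x0] := leP 0 x; last by rewrite !heat_symbol_neg// mul0r.
by rewrite !heat_symbolE// -expRD; congr expR; ring.
Qed.

Lemma heat_functional_calculus t u : 0 < t ->
  functional_calculus E (heat_symbol t) u (P t u).
Proof.
move=> t0; have [_ h] := PE u t0; move=> v.
have m2 : measurable_fun setT (fun x : R => expR (- (x * t))).
  apply: (measurableT_comp (@measurable_expR R)).
  by apply: measurable_funN; exact: measurable_funM.
have eqr (m : {measure set (measurableTypeR R) -> \bar R}) :
    \int[m]_(x in `[0, +oo[) expR (- (x * t)) = \int[m]_x heat_symbol t x.
  rewrite Rintegral_mkcond; apply: eq_Rintegral => x _.
  rewrite /heat_symbol indicE patchE; case: ifPn => _.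
    by rewrite mulr1.
  by rewrite mulr0.
rewrite h /spectral_form ?eqr//=.
apply: (@le_lt_trans _ _ (\int[pvm_measure E v]_(x in `[0%R, +oo[) 1%:E)%E); last first.
  rewrite integral_cst ?mul1e//.
  apply: (@le_lt_trans _ _ (pvm_measure E v setT)); last first.
    by rewrite pvm_measureT ltry.
  by apply: le_measure; rewrite ?inE//; exact: measurable_itv.
apply: ge0_le_integral => //.
- by apply/measurable_EFinP/measurable_funTS/measurable_funX.
move=> x; rewrite /= in_itv/= andbT => x0.
by rewrite lee_fin exprn_ile1// ?expR_ge0// expR_le1 oppr_le0 mulr_ge0// ltW.
Qed.

Let hfc := heat_functional_calculus.
Let hbb := heat_symbol_bounded_borel.

Lemma heat_sym t u v : 0 < t -> dot (P t u) v = dot u (P t v).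
Proof.
move=> t0; have e w w' : dot (P t w) w' = spectral_form E w w' (heat_symbol t).
  exact: hfc.
by rewrite e (dotC u) e spectral_formC//; exact: hbb.
Qed.

Lemma heat_ae t u u' : 0 < t -> u = u' %[ae mu] -> P t u = P t u' %[ae mu].
Proof.
move=> t0 uu'; apply: dot_ext => v; rewrite !heat_sym//.
by apply: dot_ae => //; exact: ae_eq_refl.
Qed.

Lemma heat_semigroup s t u : 0 < s -> 0 < t ->
  P s (P t u) = P (s + t) u %[ae mu].
Proof.
move=> s0 t0; apply: (functional_calculus_uniq _ (hfc u (addr_gt0 s0 t0))).
have -> : heat_symbol (s + t) = fun x => heat_symbol t x * heat_symbol s x.
  by apply/funext => x; rewrite mulrC heat_symbolD.
exact: functional_calculus_comp (hbb t0) (hbb s0) (hfc _ t0) (hfc _ s0).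
Qed.

Lemma heat_contraction t u : 0 < t -> norm2 (P t u) <= norm2 u.
Proof.
move=> t0; rewrite -[leRHS]mul1r.
apply: (functional_calculus_norm (hbb t0) (hfc u t0)) => // x.
exact: heat_symbol_le1.
Qed.

Lemma heat_commute t u w : 0 < t -> A u w -> A (P t u) (P t w).
Proof.
by move=> t0; apply: (operator_commute AE (hbb t0)) => v; exact: hfc.
Qed.

(** An adjoint is defined by identities that pass to the limit. *)
Lemma operator_closed (u_ w_ : nat -> L2 mu) u w :
  (forall n, A (u_ n) (w_ n)) -> cvg2 u_ u -> cvg2 w_ w -> A u w.
Proof.
move=> Auw uu ww; have [_ _ sa] := saA; apply/sa => v z vz.
have cu := cvg2_dot (v := z) uu; have cw := cvg2_dot (v := v) ww.
have e : (fun n => dot (u_ n) z) = (fun n => dot (w_ n) v).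
  apply/funext => n; have /sa := Auw n; move=> /(_ v z vz).
  by rewrite dotC => ->; exact: dotC.
rewrite e in cu; have := cvg_unique (@Rhausdorff R) cu cw.
by move=> h; rewrite dotC h; exact: dotC.
Qed.

(** The symbol of the difference quotient (P_t - P_(t+h)) / h. *)
Definition quotient_symbol t h x :=
  h^-1 * (- 1 * heat_symbol (t + h) x + heat_symbol t x).

Lemma expRN_mul_le t x : 0 < t -> 0 <= x -> x * expR (- (x * t)) <= t^-1.
Proof.
move=> t0 x0; rewrite expRN ler_pdivrMr ?expR_gt0// mulrC ler_pdivlMr//.
by rewrite (le_trans _ (expR_ge1Dx _))// lerDr.
Qed.

(** As h decreases to 0 the symbol tends to x e^(-xt), uniformly in x at a rate
    proportional to h. With y = xh this rests on 1 - y <= e^(-y) <= 1 - y + y^2,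
    and the resulting x^2 e^(-xt) is the square of x e^(-xt/2) <= 2 / t. *)
Lemma quotient_symbol_bounds t h x : 0 < t -> 0 < h ->
  [/\ 0 <= quotient_symbol t h x <= t^-1,
      `|x * heat_symbol t x| <= t^-1
    & `|quotient_symbol t h x - x * heat_symbol t x| <= 4 / t ^+ 2 * h].
Proof.
move=> t0 h0; have ti0 : 0 <= t^-1 by rewrite invr_ge0 ltW.
have c0 : 0 <= 4 / t ^+ 2 * h by rewrite mulr_ge0 ?divr_ge0 ?sqr_ge0// ltW.
have [x0|x0] := leP 0 x; last first.
  by rewrite /quotient_symbol !heat_symbol_neg// !(mulr0, addr0, subr0) normr0;
    split => //; rewrite lexx.
rewrite /quotient_symbol !heat_symbolE//.
have -> : - (x * (t + h)) = - (x * t) + - (x * h) by ring.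
rewrite expRD; set e := expR (- (x * t)); set f := expR (- (x * h)).
have e0 : 0 <= e by exact: expR_ge0.
have xh0 : 0 <= x * h by rewrite mulr_ge0// ltW.
have fl : 1 - x * h <= f by exact: expR_ge1Dx.
have fu : f <= 1 - x * h + (x * h) ^+ 2.
  have fi : f * (1 + x * h) <= 1.
    rewrite /f expRN mulrC ler_pdivrMr ?expR_gt0// mul1r; exact: expR_ge1Dx.
  have f0 : 0 <= f by exact: expR_ge0.
  have y3 : 0 <= (x * h) ^+ 3 by exact: exprn_ge0.
  have : 0 <= (1 + x * h) * (1 - x * h + (x * h) ^+ 2 - f).
    rewrite (_ : _ * _ = 1 + (x * h) ^+ 3 - f * (1 + x * h)); last by ring.
    by lra.
  by rewrite pmulr_rge0 ?subr_ge0//; lra.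
have -> : h^-1 * (- 1 * (e * f) + e) = e * ((1 - f) / h) by ring.
have q1 : (1 - f) / h <= x by rewrite ler_pdivrMr//; lra.
have q0 : 0 <= (1 - f) / h.
  by apply: divr_ge0; [rewrite subr_ge0 /f expR_le1 oppr_le0|exact: ltW].
have q2 : x - x ^+ 2 * h <= (1 - f) / h by rewrite ler_pdivlMr//; nra.
have xe := expRN_mul_le t0 x0; rewrite -/e in xe.
have t20 : 0 < t / 2 by rewrite divr_gt0.
have := expRN_mul_le t20 x0; set g := expR _ => xg.
have eg : e = g * g by rewrite /e /g -expRD; congr expR; field.
have g0 : 0 <= g by exact: expR_ge0.
split.
- by rewrite mulr_ge0//=; nra.
- by rewrite ger0_norm// mulr_ge0.
- rewrite distrC ger0_norm; last by nra.
  have -> : 4 / t ^+ 2 * h = ((t / 2)^-1 * (t / 2)^-1) * h.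
    by field; rewrite gt_eqF.
  have : (x * g) * (x * g) <= (t / 2)^-1 * (t / 2)^-1.
    by apply: ler_pM => //; exact: mulr_ge0.
  by rewrite eg; nra.
Qed.

Lemma quotient_symbol_bounded_borel t h : 0 < t -> 0 < h ->
  bounded_borel (quotient_symbol t h).
Proof.
move=> t0 h0; split; last first.
  exists t^-1 => x; have [/andP[q0 q1] _ _] := quotient_symbol_bounds x t0 h0.
  by rewrite ger0_norm.
apply: measurable_funM => //; apply: measurable_funD.
  by apply: measurable_funM => //; exact: heat_symbol_measurable.
exact: heat_symbol_measurable.
Qed.

Lemma generator_symbol_bounded_borel t : 0 < t ->
  bounded_borel (fun x => x * heat_symbol t x).
Proof.
move=> t0; split.
  by apply: measurable_funM => //; exact: heat_symbol_measurable.
by exists t^-1 => x; have [] := quotient_symbol_bounds x t0 t0.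
Qed.

Definition heat_quotient t h u : L2 mu :=
  h^-1 *: (- 1 *: P (t + h) u + P t u).

Lemma heat_quotient_calculus t h u : 0 < t -> 0 < h ->
  functional_calculus E (quotient_symbol t h) u (heat_quotient t h u).
Proof.
move=> t0 h0; have th0 : 0 < t + h by exact: addr_gt0.
have lin := functional_calculus_lin (- 1) (hbb th0) (hbb t0)
  (hfc u th0) (hfc u t0).
have blin := bounded_borel_lin (- 1) (hbb th0) (hbb t0).
move=> v; rewrite /heat_quotient dotZl lin.
have b0 : bounded_borel (fun x : R => 0 * heat_symbol t x + heat_symbol t x).
  exact: bounded_borel_lin (hbb t0) (hbb t0).
have [l _] := spectral_form_functional E u v.
have := l h^-1 _ _ blin (bounded_borel_lin (- 1) (hbb t0) (hbb t0)).
rewrite (l (- 1) _ _ (hbb t0) (hbb t0)) mulN1r addNr addr0 => <-.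
by congr spectral_form; apply/funext => x; rewrite /quotient_symbol; ring.
Qed.

(** This bound and the next are the analyticity of the semigroup: they replace
    the norm of the generator composed with P_t, which is at most 1 / t, before
    that composition is known to be defined. *)
Lemma heat_quotient_norm t h u : 0 < t -> 0 < h ->
  norm2 (heat_quotient t h u) <= t^-1 * norm2 u.
Proof.
move=> t0 h0; apply: (functional_calculus_norm
  (quotient_symbol_bounded_borel t0 h0) (heat_quotient_calculus u t0 h0)).
  by rewrite invr_ge0 ltW.
move=> x; have [/andP[q0 q1] _ _] := quotient_symbol_bounds x t0 h0.
by rewrite ger0_norm.
Qed.

Lemma heat_quotientB_norm t h k u : 0 < t -> 0 < h -> 0 < k ->
  norm2 (heat_quotient t h u - heat_quotient t k u)
  <= 4 / t ^+ 2 * (h + k) * norm2 u.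
Proof.
move=> t0 h0 k0.
have -> : heat_quotient t h u - heat_quotient t k u
    = - 1 *: heat_quotient t k u + heat_quotient t h u.
  by rewrite scaleN1r addrC.
have qb := quotient_symbol_bounded_borel.
apply: (functional_calculus_norm _ (functional_calculus_lin (- 1) (qb _ _ t0 k0)
  (qb _ _ t0 h0) (heat_quotient_calculus u t0 k0)
  (heat_quotient_calculus u t0 h0))).
- exact: bounded_borel_lin (qb _ _ t0 k0) (qb _ _ t0 h0).
- by rewrite mulr_ge0 ?addr_ge0 ?divr_ge0 ?sqr_ge0// ltW.
move=> x; have [_ _ h1] := quotient_symbol_bounds x t0 h0.
have [_ _ k1] := quotient_symbol_bounds x t0 k0.
rewrite mulrDr; apply: le_trans (lerD h1 k1).
rewrite -[in leRHS](normrN (quotient_symbol t k x - _)).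
by rewrite (le_trans _ (ler_normD _ _))// le_eqVlt; apply/orP; left; apply/eqP;
  congr (`| _ |); ring.
Qed.

(** The strong limit of the difference quotients is the image of P_t u under
    the generator. *)
Lemma heat_generator t (h_ : nat -> R) u w : 0 < t -> (forall n, 0 < h_ n) ->
  h_ @ \oo --> (0 : R) -> cvg2 (fun n => heat_quotient t (h_ n) u) w ->
  A (P t u) w.
Proof.
move=> t0 h0 hh qw; apply: (operator_functional_calculus AE (hbb t0)
  (generator_symbol_bounded_borel t0) (hfc u t0)) => v.
have qv := cvg2_dot (v := v) qw.
have : (fun n => spectral_form E u v (quotient_symbol t (h_ n))) @ \oo -->
    spectral_form E u v (fun x => x * heat_symbol t x).
  apply: (@spectral_form_cvg _ _ _ _ _ _ _ _ _ t^-1) => //.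
  - by move=> n; exact: (quotient_symbol_bounded_borel t0 (h0 n)).1.
  - exact: (generator_symbol_bounded_borel t0).1.
  - move=> n x; have [/andP[q0 q1] _ _] := quotient_symbol_bounds x t0 (h0 n).
    by rewrite ger0_norm.
  - move=> x; apply/cvgrPdist_le => e e0.
    have c0 : 0 < 4 / t ^+ 2 by rewrite divr_gt0 ?exprn_gt0.
    have d0 : 0 < e / (4 / t ^+ 2) by rewrite divr_gt0.
    move/cvgr0Pnorm_le : hh => /(_ _ d0); apply: filterS => n.
    rewrite gtr0_norm// ler_pdivlMr// => hn.
    have [_ _ q] := quotient_symbol_bounds x t0 (h0 n).
    by rewrite distrC (le_trans q)// mulrC.
have -> : (fun n => spectral_form E u v (quotient_symbol t (h_ n)))
    = (fun n => dot (heat_quotient t (h_ n) u) v).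
  by apply/funext => n; rewrite (heat_quotient_calculus u t0 (h0 n)).
by move=> /(cvg_unique (@Rhausdorff R) qv).
Qed.

(** A vector that the operator annihilates is not charged by the spectrum on
    either side of 0, which sigma = 1 and sigma = - 1 will express: with
    y = E(B)u, the integral of x against <E(.)y,y> is <A y, y> = 0, while
    sigma x is positive on B. *)
Lemma operator_kernel_pvm (B : set (measurableTypeR R)) (sigma : R) u :
  A u 0 -> measurable B -> (forall x, B x -> 0 < sigma * x) ->
  spectral_form E u u \1_B = 0.
Proof.
move=> Au0 mB sB; have bB := bounded_borel_indic mB.
pose y := pvm E B u; have uy := functional_calculus_pvm E u mB.
have Ay : A y (pvm E B 0).
  apply: (@operator_commute _ _ _ _ E A AE \1_B (pvm E B) u 0 bB) Au0 => v.
  exact: functional_calculus_pvm.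
have /(spectral_operatorP AE)[dy hy] := Ay.
have y0 : spectral_form E y y id = 0.
  by rewrite -hy// pvm_sym// dot0l.
pose h n x := sigma * (\1_B x * clip n x).
have bh n : bounded_borel (h n).
  have b : bounded_borel (fun x => \1_B x * clip n x).
    exact/bounded_borelM/clip_bounded_borel.
  apply: (@bounded_borelM _ (cst sigma)) => //.
  by split => //; exists `|sigma|.
have hE n : \int[pvm_measure E u]_x h n x = sigma * spectral_form E y y (clip n).
  have bc := @clip_bounded_borel R n.
  have bbc := bounded_borelM bB bc.
  rewrite (functional_calculus_form _ bB uy)// spectral_formC//.
  rewrite (functional_calculus_form _ bB uy)// spectral_form_diag; last first.
    exact: bounded_borelM.
  rewrite -RintegralZl//; last first.
    by apply: bounded_borel_integrable; exact: bounded_borelM.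
  apply: eq_Rintegral => x _; rewrite /h indicE.
  by case: (_ \in _); rewrite ?mul1r// !mul0r.
have h0 n x : 0 <= h n x.
  rewrite /h /clip !indicE; have [|_] := boolP (x \in B); last by rewrite mul0r mulr0.
  rewrite inE => /sB sx; rewrite mul1r mulrA mulr_ge0// ltW//.
have hnd x m n : (m <= n)%N -> h m x <= h n x.
  move=> mn; rewrite /h /clip !indicE.
  have [|_] := boolP (x \in B); last by rewrite !mul0r.
  rewrite inE => /sB sx; rewrite !mul1r !mulrA ler_wpM2l ?(ltW sx)//.
  have [|_] := boolP (_ \in `[- m%:R, _]%classic); last by rewrite ler0n.
  rewrite inE/= in_itv/= => /andP[xm mx].
  have nm : m%:R <= n%:R :> R by rewrite ler_nat.
  by rewrite mem_set//= in_itv/=; apply/andP; split; lra.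
have int0 n : \int[pvm_measure E u]_x h n x = 0.
  apply/eqP; rewrite eq_le; apply/andP; split; last first.
    by apply: Rintegral_ge0 => x _; exact: h0.
  have lim : (fun n => \int[pvm_measure E u]_x h n x) @ \oo --> (0 : R).
    have -> : (fun n => \int[pvm_measure E u]_x h n x)
        = (fun n => sigma * spectral_form E y y (clip n)) by exact/funext.
    rewrite -(mulr0 sigma) -y0; apply: cvgMr; exact: spectral_form_clip_cvg.
  apply: (cvgr_to_ge lim); near=> m; apply: le_Rintegral => //.
  - exact: bounded_borel_integrable.
  - exact: bounded_borel_integrable.
  - by move=> x _; apply: hnd; near: m; exists n.
(* bounded functions with integral 0 that increase to the indicator of B *)
pose k n x := Num.min 1 (n%:R * h n x).
have mk n : measurable_fun setT (k n).
  have [mh _] := bh n.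
  by apply: measurable_minr => //; apply: measurable_funM.
have k1 n x : `|k n x| <= 1.
  by rewrite ger0_norm ?ge_min ?lexx// le_min ler01 mulr_ge0.
have bk n : bounded_borel (k n) by split; [exact: mk|exists 1; exact: k1].
have kint n : spectral_form E u u (k n) = 0.
  rewrite spectral_form_diag//; apply/eqP; rewrite eq_le; apply/andP; split.
    rewrite -(mulr0 n%:R) -(int0 n) -RintegralZl//; last first.
      exact: bounded_borel_integrable.
    apply: le_Rintegral => //; first exact: bounded_borel_integrable.
      apply: bounded_borel_integrable; apply: (@bounded_borelM _ (cst n%:R)) => //.
      by split => //; exists `|n%:R|.
    by move=> x _; rewrite ge_min lexx orbT.
  by apply: Rintegral_ge0 => x _; rewrite le_min ler01 mulr_ge0.
have : (fun n => spectral_form E u u (k n)) @ \oo --> spectral_form E u u \1_B.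
  apply: (@spectral_form_cvg _ _ _ _ _ _ _ _ _ 1) => //.
  move=> x; apply: cvg_near_cst; rewrite indicE.
  have [xB|xB] := boolP (x \in B); last first.
    by apply: nearW => n; rewrite /k /h indicE (negbTE xB) mul0r !mulr0 min_r.
  have sx : 0 < sigma * x by move: xB; rewrite inE => /sB.
  near=> n; have cx : clip n x = x by near: n; exact: clip_near.
  rewrite /k /h indicE xB mul1r cx min_l// -ler_pdivrMr//.
  near: n; exact: nbhs_infty_ger.
have -> : (fun n => spectral_form E u u (k n)) = cst 0 by apply/funext.
by move=> c; apply: (cvg_unique (@Rhausdorff R) c); exact: cvg_cst.
Unshelve. all: by end_near. Qed.

(** (1 - e^(-xt))^2 vanishes at 0, the only point charged by u. *)
Lemma heat_fixed t u : 0 < t -> A u 0 -> P t u = u %[ae mu].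
Proof.
move=> t0 Au; have b1 := bounded_borel_indic (R := R) measurableT.
have u1 : functional_calculus E \1_setT u u.
  move=> v; rewrite spectral_form_indic//.
  by apply: dot_ae; [apply: ae_eq_sym; exact: pvmT|exact: ae_eq_refl].
have dB := functional_calculus_lin (- 1) b1 (hbb t0) u1 (hfc u t0).
have bB := bounded_borel_lin (- 1) b1 (hbb t0).
apply: ae_eq_sub0; apply: dot_self_eq0.
have -> : P t u - u = - 1 *: u + P t u by rewrite scaleN1r addrC.
rewrite (functional_calculus_dot bB dB).
pose p : set (measurableTypeR R) := `]0, +oo[%classic.
pose n : set (measurableTypeR R) := `]-oo, 0[%classic.
have mp : measurable p by exact: measurable_itv.
have mn : measurable n by exact: measurable_itv.
have p0 : spectral_form E u u \1_p = 0.
  apply: (@operator_kernel_pvm _ 1) => // x.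
  by rewrite /p/= in_itv/= andbT mul1r.
have n0 : spectral_form E u u \1_n = 0.
  apply: (@operator_kernel_pvm _ (- 1)) => // x.
  by rewrite /n/= in_itv/= mulN1r oppr_gt0.
have bpn := bounded_borel_lin 1 (bounded_borel_indic mp) (bounded_borel_indic mn).
have : spectral_form E u u (fun x => 1 * \1_p x + \1_n x) = 0.
  have [l _] := spectral_form_functional E u u.
  by rewrite l ?p0 ?n0 ?mulr0 ?addr0//; exact: bounded_borel_indic.
rewrite spectral_form_diag// => pn0.
apply/eqP; rewrite eq_le; apply/andP; split; last first.
  by apply: Rintegral_ge0 => x _; rewrite -expr2 sqr_ge0.
rewrite -pn0; apply: le_Rintegral => //.
- by apply: bounded_borel_integrable; exact: bounded_borelM.
- exact: bounded_borel_integrable.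
move=> x _; rewrite indicT mulr1 mul1r !indicE /p /n !mem_setE !in_itv/= andbT.
have := heat_symbol_le1 x t0; rewrite ger0_norm ?heat_symbol_ge0// => h1.
have h0 := heat_symbol_ge0 t x.
have [x0|x0|x0] := ltgtP x 0; [by rewrite /= ?mulr0n ?mulr1n; nra..|].
by rewrite x0 heat_symbolE// mul0r oppr0 expR0 addNr mul0r addr0.
Qed.

End HeatSemigroup.

(** * Borel measures on a metric space *)

Section BorelMetric.
Context {R : realType} {X : pmetricType R}.
Context {mu : {measure set (borel X) -> \bar R}}.

Lemma open_borel (U : set X) : open U -> measurable (U : set (borel X)).
Proof. by move=> oU; exact: sub_sigma_algebra. Qed.

Lemma closed_borel (C : set X) : closed C -> measurable (C : set (borel X)).
Proof.
move=> cC; rewrite -[C]setCK; apply: measurableC; apply: open_borel.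
exact: closed_openC.
Qed.

Lemma continuous_borel (f : X -> R) : continuous f ->
  measurable_fun (setT : set (borel X)) f.
Proof.
move=> /continuousP cf; apply: (measurability _ (RGenOpens.measurableE R)).
move=> _ [_ [a [b ->] <-]]; rewrite setTI; apply: open_borel.
exact/cf/interval_open.
Qed.

(* Properties of points are stated on [X], almost-everywhere filters live on
   [borel X]; the two lemmas make the passage once and for all. *)
Lemma ae_mono (Q Q' : X -> Prop) : (forall x, Q x -> Q' x) ->
  {ae mu, forall x, Q x} -> {ae mu, forall x, Q' x}.
Proof. exact: (@filterS _ _ (ae_filter_ringOfSetsType mu)). Qed.

Lemma ae_and (Q Q' : X -> Prop) : {ae mu, forall x, Q x} ->
  {ae mu, forall x, Q' x} -> {ae mu, forall x, Q x /\ Q' x}.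
Proof. exact: (@filterI _ _ (ae_filter_ringOfSetsType mu)). Qed.

Definition measure_support : set X :=
  [set x | forall U : set X, open U -> U x -> mu U != 0].

Lemma measure_support_closed : closed measure_support.
Proof.
rewrite -[measure_support]setCK; apply: open_closedC; rewrite openE => x.
move=> /existsNP[U] /not_implyP[oU] /not_implyP[Ux] /negP/negPn/eqP U0.
rewrite /interior nbhsE; exists U => // y Uy.
by move=> /(_ U oU Uy); rewrite U0 eqxx.
Qed.

(** What holds almost everywhere holds somewhere in each neighborhood of a point
    of the support; continuity then turns almost-everywhere relations into
    relations at every point of the support. *)
Lemma support_ae_witness (U : set X) (Q : X -> Prop) x :
  measure_support x -> open U -> U x -> {ae mu, forall y, Q y} ->
  exists2 y, U y & Q y.
Proof.
move=> Sx oU Ux [N [mN N0 QN]]; apply: contrapT => nQ.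
have UN : U `<=` N by move=> y Uy; apply: QN => Qy; apply: nQ; exists y.
have := Sx U oU Ux; rewrite -measure_le0 -N0 le_measure// inE//.
exact: open_borel.
Qed.

Lemma continuous_ae_ge0 (f : X -> R) : continuous f ->
  {ae mu, forall x, 0 <= f x} -> forall x, measure_support x -> 0 <= f x.
Proof.
move=> cf f0 x Sx; rewrite leNgt; apply/negP => fx.
have oU : open [set y | f y < 0].
  by rewrite (_ : mkset _ = f @^-1` `]-oo, 0[%classic);
    [move/continuousP : cf; apply; exact: interval_open|
     apply/seteqP; split => y; rewrite /= in_itv].
have [y /= fy] := support_ae_witness Sx oU fx f0.
by rewrite leNgt fy.
Qed.

Lemma continuous_ae_eq (f g : X -> R) : continuous f -> continuous g ->
  {ae mu, forall x, f x = g x} -> forall x, measure_support x -> f x = g x.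
Proof.
move=> cf cg fg x Sx.
have le (h k : X -> R) : continuous h -> continuous k ->
    {ae mu, forall y, h y = k y} -> k x <= h x.
  move=> ch ck hk; rewrite -subr_ge0.
  apply: (continuous_ae_ge0 (f := fun y => h y - k y)) Sx.
    by move=> y; apply: cvgB; [exact: ch|exact: ck].
  by apply: ae_mono hk => y ->; rewrite subrr.
have gf : {ae mu, forall y, g y = f y} by apply: ae_mono fg.
apply/eqP; rewrite eq_le; apply/andP; split; exact: le.
Qed.

Context (muT : (mu setT < +oo)%E).

Definition sqrt_mass : R := Num.sqrt (fine (mu setT)).

Lemma sqrt_mass_ge0 : 0 <= sqrt_mass. Proof. exact: sqrtr_ge0. Qed.

Lemma bounded_L2 (f : X -> R) : measurable_fun (setT : set (borel X)) f ->
  (exists C, forall x, `|f x| <= C) -> exists u : L2 mu, (u : X -> R) = f.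
Proof.
move=> mf [C fC].
have fL : f \in Lfun mu 2%:R%:E.
  rewrite inE; apply/andP; split; rewrite inE//=.
  rewrite /finite_norm unlock poweR_lty//.
  apply: (@le_lt_trans _ _ (\int[mu]_x (C `^ 2)%:E)%E); last first.
    by rewrite integral_cst// lte_mul_pinfty ?lee_fin ?powR_ge0.
  apply: ge0_le_integral => //.
  - by move=> x _; rewrite lee_fin powR_ge0.
  - apply/measurable_EFinP.
    apply: (@measurableT_comp _ _ _ _ _ _ (@powR R ^~ 2)) => //.
    exact: measurableT_comp.
  - move=> x _; rewrite lee_fin ge0_ler_powR// nnegrE ?normr_ge0//.
    exact: le_trans (fC x).
by exists (Lfun_Sub (lee1n 2) fL).
Qed.

Lemma norm2_bounded (u : L2 mu) (C : R) : (forall x, `|u x| <= C) ->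
  norm2 u <= C * sqrt_mass.
Proof.
move=> uC; have C0 : 0 <= C by exact: le_trans (normr_ge0 _) (uC point).
apply: norm2_le; first by rewrite mulr_ge0// sqrt_mass_ge0.
rewrite exprMn sqr_sqrtr ?fine_ge0//.
have -> : C ^+ 2 * fine (mu setT) = \int[mu]_x (C ^+ 2) by rewrite Rintegral_cst.
apply: le_Rintegral => //; first exact: dot_integrable.
  apply: (@measurable_bounded_integrable _ _ _ mu (cst (C ^+ 2))) => //.
  exists `|C ^+ 2|; split => [|x Cx y _]; first by rewrite num_real.
  exact: ltW.
move=> x _; have := uC x; rewrite ler_norml => /andP[? ?]; nra.
Qed.

End BorelMetric.
Arguments measure_support {R X} mu.
Arguments sqrt_mass {R X} mu.

(** * The heat kernel *)

Lemma continuous_pos_part {R : realType} : continuous (fun r : R => Num.max r 0).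
Proof.
by move=> r; apply: (@continuous_max _ _ id (cst 0)); [exact: cvg_id|exact: cvg_cst].
Qed.

Lemma sequentially_continuous {R : realType} {X : pmetricType R} (f : X -> R) :
  (forall (x : X) (x_ : nat -> X),
     (fun n => mdist x (x_ n)) @ \oo --> (0 : R) ->
     (fun n => f (x_ n)) @ \oo --> f x) -> continuous f.
Proof.
move=> sf x; apply/cvgrPdist_lt => e e0; apply: contrapT => nx.
have ex (n : nat) : exists y, mdist x y < n.+1%:R^-1 /\ e <= `|f x - f y|.
  apply: contrapT => nexy; apply: nx; apply/nbhs_ballP.
  exists n.+1%:R^-1 => /=; first by rewrite invr_gt0.
  move=> y; rewrite ballEmdist /= => xy; rewrite ltNge; apply/negP => ey.
  by apply: nexy; exists y.
have [x_ hx] := choice ex.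
have xx : (fun n => mdist x (x_ n)) @ \oo --> (0 : R).
  apply: (@squeeze_cvgr _ _ _ _ (cst 0) (fun n => n.+1%:R^-1)).
  - by apply: nearW => n; rewrite mdist_ge0/= ltW//; exact: (hx n).1.
  - exact: cvg_cst.
  - exact: cvg_harmonic.
have := sf x x_ xx; move/cvgrPdist_lt => /(_ e e0) [N _ /(_ N (leqnn N))] /=.
by rewrite ltNge (hx N).2.
Qed.

Section HeatKernel.
Context {R : realType} {X : pmetricType R}.
Context {mu : {measure set (borel X) -> \bar R}}.
Context (muT : (mu setT < +oo)%E).
Context (A : operator mu) (E : proj_measure mu) (P : R -> L2 mu -> L2 mu).
Hypothesis AE : spectral_resolution A E.
Hypothesis PE : heat_operators E P.
Hypothesis markovP : markov_operators P.
Context (one : L2 mu) (oneE : (one : X -> R) = cst 1).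
Hypothesis A1 : A one 0.
Context (p : R -> X -> X -> R) (t0 : R) (t0_gt0 : 0 < t0).
Hypothesis pP : continuous_heat_kernel P p.
Context (b : R -> R -> R).
Hypothesis pb : forall (t : R) x y, 0 < t < t0 -> p t x y <= b t (mdist x y).
Hypothesis b_ge0 : forall t r : R, 0 < t < t0 -> 0 <= b t r.
Hypothesis b_anti : forall t r r' : R, 0 < t < t0 -> 0 <= r <= r' -> b t r' <= b t r.
Hypothesis b_cvg : forall (r : R) (t_ : nat -> R), 0 < r ->
  (forall n, 0 < t_ n < t0) -> t_ @ \oo --> (0 : R) ->
  (fun n => b (t_ n) r) @ \oo --> (0 : R).
Implicit Types (f g : L2 mu) (t : R).

Let S := measure_support mu.
Let M := sqrt_mass mu.

Let M_sqr : M ^+ 2 = fine (mu setT).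
Proof. by rewrite sqr_sqrtr// fine_ge0. Qed.

Lemma kernel_continuous_r t x : 0 < t -> continuous (p t x).
Proof.
move=> t1; have [cp _] := pP t1; move=> y.
apply: (@cvg_comp _ _ _ (fun y => (x, y)) (fun z => p t z.1 z.2) _
  (nbhs (x, y))); last exact: (cp (x, y)).
by apply: cvg_pair; [exact: cvg_cst|exact: cvg_id].
Qed.

Lemma kernel_continuous_l t y : 0 < t -> continuous (fun x => p t x y).
Proof.
move=> t1; have [cp _] := pP t1; move=> x.
apply: (@cvg_comp _ _ _ (fun x => (x, y)) (fun z => p t z.1 z.2) _
  (nbhs (x, y))); last exact: (cp (x, y)).
by apply: cvg_pair; [exact: cvg_id|exact: cvg_cst].
Qed.

Let const_integrable (c : R) : mu.-integrable setT (EFin \o cst c).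
Proof.
apply: measurable_bounded_integrable => //.
exists `|c|; split => [|x cx y _]; first by rewrite num_real.
exact: ltW.
Qed.

Lemma heat_one t : 0 < t -> {ae mu, forall x, P t one x = 1}.
Proof.
move=> t1; have := heat_fixed AE PE t1 A1; apply: ae_mono => x /(_ I) ->.
by rewrite oneE.
Qed.

(** At a point outside the support, [P_t 1 = 1] would be carried by points at
    a distance bounded below, where the kernel vanishes as t decreases to 0. *)
Lemma ae_support : {ae mu, forall x, S x}.
Proof.
pose t_ n := t0 / 2 * n.+1%:R^-1.
have tn n : 0 < t_ n < t0.
  rewrite mulr_gt0 ?divr_gt0 ?invr_gt0//=.
  apply: (@le_lt_trans _ _ (t0 / 2)); last by have := t0_gt0; lra.
  by rewrite ler_piMr ?divr_ge0 ?(ltW t0_gt0)// invf_le1// ler1n.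
have tn0 n : 0 < t_ n by have /andP[] := tn n.
have t_cvg : t_ @ \oo --> (0 : R).
  by rewrite -(mulr0 (t0 / 2)); apply: cvgMr; exact: cvg_harmonic.
have h n : {ae mu, forall x, P (t_ n) one x = 1 /\
  (mu.-integrable setT (fun y => (p (t_ n) x y * one y)%:E) /\
  P (t_ n) one x = \int[mu]_y (p (t_ n) x y * one y))}.
  apply: ae_and; first exact: heat_one.
  exact: (pP (tn0 n)).2.
have := ae_foralln h; apply: ae_mono => x hx U oU Ux; apply/negP => /eqP U0.
have /nbhs_ballP[e /= e0 eU] : nbhs x U by exact: open_nbhs_nbhs.
have mU : measurable (U : set (borel X)) by exact: open_borel.
have le1 n : 1 <= M ^+ 2 * b (t_ n) e.
  have [P1 [ip PI]] := hx n.
  rewrite -[leLHS]P1 PI M_sqr mulrC -Rintegral_cst//.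
  have -> : \int[mu]_y (p (t_ n) x y * one y) =
      \int[mu]_(y in ~` U) (p (t_ n) x y * one y).
    rewrite /Rintegral (negligible_integral mU _ ip)//; first by rewrite setTD.
  have -> : \int[mu]_(y in setT) b (t_ n) e = \int[mu]_(y in ~` U) b (t_ n) e.
    rewrite /Rintegral (negligible_integral mU _ (const_integrable _))//.
    by rewrite setTD.
  apply: le_Rintegral; first exact: measurableC.
  - by apply: integrableS ip => //; exact: measurableC.
  - by apply: integrableS (const_integrable (b (t_ n) e)) => //; exact: measurableC.
  move=> y Uy; rewrite oneE mulr1 (le_trans (pb x y (tn n)))//.
  apply: b_anti => //; rewrite (ltW e0)/= leNgt; apply/negP => xy.
  by apply: Uy; apply: eU; rewrite ballEmdist.
have c : (fun n => M ^+ 2 * b (t_ n) e) @ \oo --> (0 : R).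
  by rewrite -(mulr0 (M ^+ 2)); apply: cvgMr; exact: b_cvg.
have : 1 <= 0 :> R by apply: (cvgr_to_ge c); apply: nearW.
by rewrite ler10.
Qed.

(** Positivity of the heat flow makes the kernel nonnegative on the support; at
    other points nothing prevents it from being negative. *)
Lemma kernel_ge0 t x y : 0 < t -> S x -> S y -> 0 <= p t x y.
Proof.
move=> t1 Sx Sy; rewrite leNgt; apply/negP => pxy.
have [cp kp] := pP t1.
have cxy : (fun z : X * X => p t z.1 z.2) @ (x, y) --> p t x y := cp (x, y).
have half : p t x y < p t x y / 2 by lra.
have [[/= U V] [Ux Vy] UV] := cvgr_lt _ cxy _ half.
move: Ux Vy; rewrite !nbhsE => -[U' [oU Ux'] UU] [V' [oV Vy'] VV].
have mV : measurable (V' : set (borel X)) by exact: open_borel.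
have [f fE] : exists f : L2 mu, (f : X -> R) = \1_V'.
  apply: (bounded_L2 muT); first exact: (@measurable_indic _ (borel X)).
  by exists 1 => z; rewrite indicE; case: (_ \in _); rewrite ?normr1 ?normr0.
have f01 : {ae mu, forall x, 0 <= f x <= 1}.
  by apply: aeW => z; rewrite fE indicE; case: (_ \in _); rewrite /= ?lexx ?ler01.
have [z Uz [Pz [iz zE]]] := support_ae_witness Sx oU Ux'
  (ae_and (markovP t1 f01) (kp f)).
have intf : mu.-integrable setT (EFin \o f).
  have := dot_integrable one f; congr integrable; apply/funext => w /=.
  by rewrite oneE mul1r.
have : \int[mu]_w (p t z w * f w) <= \int[mu]_w (p t x y / 2 * f w).
  apply: le_Rintegral => //.
    exact: (integrableZl measurableT (p t x y / 2) intf).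
  move=> w _; rewrite fE indicE.
  have [|_] := boolP (w \in V'); last by rewrite !mulr0.
  by rewrite inE !mulr1 => Vw; apply/ltW/(UV (z, w)); split; [exact: UU|exact: VV].
rewrite RintegralZl// -zE; have /andP[P0 _] := Pz => Ple.
have : 0 < fine (mu V').
  have := Sy V' oV Vy'; rewrite -measure_gt0 => V0.
  apply: fine_gt0; rewrite V0/=; apply: le_lt_trans muT.
  by apply: le_measure; rewrite ?inE.
have -> : fine (mu V') = \int[mu]_w f w.
  by rewrite fE /Rintegral integral_indic// setIT.
move: Ple; set I := Rintegral _ _ _ => Ple I0.
have : 0 <= p t x y / 2 * I by exact: le_trans Ple.
by rewrite pmulr_lge0//; lra.
Qed.

(** The kernel is replaced by its nonnegative part, equal to it on the support,
    in order that its upper bound become a bound on its absolute value at every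
    point of X, and not on the support only. *)
Definition heat_integral t f (x : X) : R :=
  \int[mu]_y (Num.max (p t x y) 0 * f y).

Lemma kernel_pos_measurable t x : 0 < t ->
  measurable_fun (setT : set (borel X)) (fun y => Num.max (p t x y) 0).
Proof.
move=> t1; apply: measurable_maxr => //; apply: continuous_borel.
exact: kernel_continuous_r.
Qed.

Lemma kernel_pos_bound t x y r : 0 < t < t0 -> 0 <= r <= mdist x y ->
  `|Num.max (p t x y) 0| <= b t r.
Proof.
move=> tt rxy; rewrite ger0_norm ?le_max ?lexx ?orbT// ge_max b_ge0// andbT.
by rewrite (le_trans (pb x y tt))// b_anti.
Qed.

Lemma kernel_section t x : 0 < t < t0 -> exists2 k : L2 mu,
  (k : X -> R) = (fun y => Num.max (p t x y) 0) & norm2 k <= b t 0 * M.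
Proof.
move=> tt; have [t1 _] := andP tt.
have kb y : `|Num.max (p t x y) 0| <= b t 0.
  by apply: kernel_pos_bound; rewrite ?lexx ?mdist_ge0.
have [k kE] := bounded_L2 muT (kernel_pos_measurable x t1) (ex_intro _ _ kb).
by exists k => //; apply: norm2_bounded => // y; rewrite kE.
Qed.

Lemma heat_integral_bound t f x : 0 < t < t0 ->
  `|heat_integral t f x| <= b t 0 * M * norm2 f.
Proof.
move=> tt; have [k kE kM] := kernel_section x tt.
have -> : heat_integral t f x = dot k f.
  by apply: eq_Rintegral => y _; rewrite kE.
by rewrite (le_trans (cauchy_schwarz _ _))// ler_wpM2r// norm2_ge0.
Qed.

(** By dominated convergence, the nonnegative part of the kernel being bounded
    for a fixed small time. *)
Lemma heat_integral_continuous t f : 0 < t < t0 -> continuous (heat_integral t f).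
Proof.
move=> tt; have [t1 _] := andP tt; apply: sequentially_continuous => x x_ xx.
have [c cE] : exists c : L2 mu, (c : X -> R) = cst (b t 0).
  by apply: bounded_L2 => //; exists `|b t 0|.
apply: (@Rintegral_dominated_cvg _ (borel X) _ mu _ _ (fun y => `|c y * f y|)).
- move=> n; apply: measurable_funM; last exact: L2_measurable.
  exact: kernel_pos_measurable.
- apply: measurable_funM; last exact: L2_measurable.
  exact: kernel_pos_measurable.
- exact: (integrable_norm (dot_integrable c f)).
- move=> n y; rewrite !normrM ler_wpM2r// cE (ger0_norm (b_ge0 _ tt)).
  by apply: kernel_pos_bound; rewrite ?lexx ?mdist_ge0.
move=> y; apply: cvgMl.
have xxn : x_ @ \oo --> x.
  apply/metricType_numDomainType.cvgrPdist_lt => e e0.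
  by move/cvgr0Pnorm_lt : xx => /(_ e e0); apply: filterS => n;
    rewrite ger0_norm ?mdist_ge0.
have px := cvg_comp _ _ xxn (@kernel_continuous_l t y t1 x).
exact: (cvg_comp _ _ px (@continuous_pos_part R _)).
Qed.

Lemma heat_integral_ge0 t f x : (forall y, 0 <= f y) -> 0 <= heat_integral t f x.
Proof.
move=> f0; apply: Rintegral_ge0 => y _.
by rewrite mulr_ge0// le_max lexx orbT.
Qed.

Lemma heat_integral_far t f x r : 0 < t < t0 -> 0 <= r ->
  (forall y, `|f y| <= 1) -> (forall y, mdist x y < r -> f y = 0) ->
  `|heat_integral t f x| <= M ^+ 2 * b t r.
Proof.
move=> tt r0 f1 fr; have [k kE _] := kernel_section x tt.
have kf := dot_integrable k f.
have -> : heat_integral t f x = dot k f.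
  by apply: eq_Rintegral => y _; rewrite kE.
rewrite (le_trans (le_normr_Rintegral _ kf))//.
rewrite M_sqr mulrC -Rintegral_cst//.
apply: le_Rintegral => //; first exact: (integrable_norm kf).
  exact: (const_integrable (b t r)).
move=> y _; rewrite normrM kE.
have [xy|xy] := ltP (mdist x y) r; first by rewrite fr// normr0 mulr0 b_ge0.
rewrite -[leRHS]mulr1 ler_pM// kernel_pos_bound//.
by rewrite r0.
Qed.

Lemma heat_integralE t f : 0 < t -> {ae mu, forall x, P t f x = heat_integral t f x}.
Proof.
move=> t1; have [_ kp] := pP t1.
have := ae_and ae_support (kp f); apply: ae_mono => x [Sx [ip ->]].
rewrite /heat_integral /Rintegral; congr fine; apply: ae_eq_integral => //.
- exact: measurable_int ip.
- apply/measurable_EFinP; apply: measurable_funM; last exact: L2_measurable.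
  exact: kernel_pos_measurable.
apply: ae_mono ae_support => y Sy _.
by rewrite max_l// kernel_ge0.
Qed.

Lemma heat_integral_L2 t f : 0 < t < t0 ->
  exists u : L2 mu, (u : X -> R) = heat_integral t f.
Proof.
move=> tt; apply: bounded_L2 => //.
  by apply: continuous_borel; exact: heat_integral_continuous.
by eexists => x; exact: heat_integral_bound.
Qed.

(** Off the support the integral may differ from 1; this is why the final
    function has to be corrected there. *)
Lemma heat_integral_one t x : 0 < t < t0 -> S x -> heat_integral t one x = 1.
Proof.
move=> tt; have [t1 _] := andP tt.
apply: (@continuous_ae_eq _ _ _ _ (cst 1)).
- exact: heat_integral_continuous.
- exact: cst_continuous.
- have := ae_and (heat_integralE one t1) (heat_one t1).
  by apply: ae_mono => y [+ P1]; rewrite P1.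
Qed.

End HeatKernel.

(** * Smoothing by the heat flow *)

Lemma uniform_cauchy_limit {R : realType} {X : topologicalType}
    (g_ : nat -> X -> R) (r_ : nat -> R) :
  (forall n, continuous (g_ n)) -> r_ @ \oo --> (0 : R) ->
  (forall m n x, (m <= n)%N -> `|g_ n x - g_ m x| <= r_ m) ->
  exists2 g, continuous g & forall n x, `|g x - g_ n x| <= r_ n.
Proof.
move=> cg r0 gr; have cv x : cvg ((fun n => g_ n x) @ \oo).
  apply/cauchy_cvgP/cauchy_exP => e e0.
  move/cvgr0Pnorm_lt : r0 => /(_ e e0) [N _ rN].
  exists (g_ N x); exists N => // n /= Nn.
  rewrite /ball/= distrC (le_lt_trans (gr _ _ _ Nn))//.
  by rewrite (le_lt_trans (ler_norm _))// rN /=.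
pose g x := lim ((fun n => g_ n x) @ \oo).
have gb n x : `|g x - g_ n x| <= r_ n.
  have : (fun m => `|g_ m x - g_ n x|) @ \oo --> `|g x - g_ n x|.
    by apply: cvg_norm; apply: cvgB; [exact: cv|exact: cvg_cst].
  move=> c; apply: (cvgr_to_le c); near=> m; apply: gr; near: m; by exists n.
exists g => // x; apply/cvgrPdist_lt => e e0.
have e3 : 0 < e / 3 by rewrite divr_gt0.
move/cvgr0Pnorm_lt : r0 => /(_ _ e3) [N _ /(_ N (leqnn N)) /= rN].
have rN' : r_ N < e / 3 by exact: le_lt_trans (ler_norm _) rN.
move/cvgrPdist_lt : (cg N x) => /(_ _ e3); apply: filterS => y gxy.
have -> : g x - g y = (g x - g_ N x) + (g_ N x - g_ N y) - (g y - g_ N y) by ring.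
have h1 := gb N x; have h2 := gb N y.
rewrite (le_lt_trans (ler_normB _ _))// (@le_lt_trans _ _
  (`|g x - g_ N x| + `|g_ N x - g_ N y| + `|g y - g_ N y|))//.
  by rewrite lerD2r ler_normD.
by lra.
Unshelve. all: by end_near. Qed.

(** The Weierstrass test for a telescoping series. *)
Lemma uniform_series_limit {R : realType} {X : topologicalType}
    (g_ : nat -> X -> R) (beta : nat -> R) (B : R) :
  (forall n, continuous (g_ n)) -> (forall n, 0 <= beta n) ->
  (forall n x, `|g_ n.+1 x - g_ n x| <= beta n) ->
  (forall n, \sum_(0 <= i < n) beta i <= B) ->
  exists g r_, [/\ continuous g, r_ @ \oo --> (0 : R) &
    forall n x, `|g x - g_ n x| <= r_ n].
Proof.
move=> cg b0 gb sB; pose s n := \sum_(0 <= i < n) beta i.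
have nds : nondecreasing_seq s.
  apply/nondecreasing_seqP => n; by rewrite /s big_nat_recr//= lerDl.
have cs : cvg (s @ \oo).
  by apply: nondecreasing_is_cvgn => //; exists B => _ [n _ <-]; exact: sB.
pose r_ n := lim (s @ \oo) - s n.
have r0 : r_ @ \oo --> (0 : R).
  by rewrite -(subrr (lim (s @ \oo))); apply: cvgB => //; exact: cvg_cst.
have [|g cg' gr] := uniform_cauchy_limit cg r0 _; last by exists g, r_.
move=> m n x mn; apply: (@le_trans _ _ (s n - s m)); last first.
  by rewrite lerD2r; exact: nondecreasing_cvgn_le.
rewrite -(subnK mn); elim: (n - m)%N => [|k ih]; first by rewrite add0n !subrr normr0.
have -> : g_ (k.+1 + m)%N x - g_ m x
    = (g_ (k + m).+1 x - g_ (k + m)%N x) + (g_ (k + m)%N x - g_ m x).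
  by rewrite addSn; ring.
rewrite (le_trans (ler_normD _ _))// addSn.
have -> : s (k + m).+1 = beta (k + m)%N + s (k + m)%N.
  by rewrite /s big_nat_recr//= addrC.
by rewrite -addrA lerD.
Qed.

Section Smoothing.
Context {R : realType} {X : pmetricType R}.
Context {mu : {measure set (borel X) -> \bar R}}.
Context (muT : (mu setT < +oo)%E).
Context (A : operator mu) (E : proj_measure mu) (P : R -> L2 mu -> L2 mu).
Hypothesis saA : self_adjoint A.
Hypothesis AE : spectral_resolution A E.
Hypothesis PE : heat_operators E P.
Implicit Types (u v w z : L2 mu) (t : R) (k : nat).

Lemma uniform_cvg2 (u_ : nat -> L2 mu) u (r_ : nat -> R) :
  (forall n x, `|u x - u_ n x| <= r_ n) -> r_ @ \oo --> (0 : R) -> cvg2 u_ u.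
Proof.
move=> ur r0.
apply: (@squeeze_cvgr _ _ _ _ (cst 0) (fun n => r_ n * sqrt_mass mu)).
- apply: nearW => n; rewrite norm2_ge0/=; apply: norm2_bounded => // x.
  by have := ur n x; rewrite distrC.
- exact: cvg_cst.
- by rewrite -(mul0r (sqrt_mass mu)); exact: cvgMl.
Qed.

Lemma cvg2_ae (u_ v_ : nat -> L2 mu) u :
  (forall n, u_ n = v_ n %[ae mu]) -> cvg2 u_ u -> cvg2 v_ u.
Proof.
move=> uv uu; apply: cvg_trans uu; apply: near_eq_cvg; apply: nearW => n.
by apply: norm2_ae; apply: aeD; [exact: uv|exact: ae_eq_refl].
Qed.

Let A_lin : linear_operator A. Proof. by case: saA. Qed.

Lemma iter_operator_ae k u u' w w' : u = u' %[ae mu] -> w = w' %[ae mu] ->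
  iter_operator A k u w -> iter_operator A k u' w'.
Proof.
elim: k u u' w w' => [|k ih] u u' w w' uu' ww' /=.
  by move=> uw; exact: ae_eq_trans (ae_eq_sym uu') (ae_eq_trans uw ww').
move=> [z uz zw]; exists z; first exact: ih uu' (ae_eq_refl _ _ _) uz.
exact: operator_ae A_lin _ _ _ _ (ae_eq_refl _ _ _) ww' zw.
Qed.

Lemma iter_operator_uniq k u w w' : iter_operator A k u w ->
  iter_operator A k u w' -> w = w' %[ae mu].
Proof.
elim: k w w' => [|k ih] w w' /=.
  by move=> uw uw'; exact: ae_eq_trans (ae_eq_sym uw) uw'.
move=> [z uz zw] [z' uz' zw']; apply: (operator_fun A_lin zw).
have zz' := ih _ _ uz' uz.
exact: operator_ae A_lin _ _ _ _ zz' (ae_eq_refl _ _ _) zw'.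
Qed.

Lemma iter_operatorD k u v w z : iter_operator A k u w ->
  iter_operator A k v z -> iter_operator A k (u + v) (w + z).
Proof.
elim: k w z => [|k ih] w z /=; first exact: aeD.
move=> [w' uw' ww'] [z' uz' zz']; exists (w' + z'); first exact: ih.
by have := operator_lin A_lin 1 ww' zz'; rewrite !scale1r.
Qed.

Lemma iter_operator0 k : iter_operator A k 0 0.
Proof.
elim: k => [|k ih] /=; first exact: ae_eq_refl.
by exists 0 => //; exact: operator0 A_lin.
Qed.

Lemma iter_operator_heat k t u w : 0 < t -> iter_operator A k u w ->
  iter_operator A k (P t u) (P t w).
Proof.
move=> t0; elim: k w => [|k ih] w /=.
  by move=> uw; exact: (heat_ae PE t0 uw).
by move=> [z uz zw]; exists (P t z); [exact: ih|exact: (heat_commute AE PE t0 zw)].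
Qed.

Context (p : R -> X -> X -> R) (t0 : R) (b : R -> R -> R).
Hypothesis pP : continuous_heat_kernel P p.
Hypothesis pb : forall (t : R) x y, 0 < t < t0 -> p t x y <= b t (mdist x y).
Hypothesis b_ge0 : forall t r : R, 0 < t < t0 -> 0 <= b t r.
Hypothesis b_anti : forall t r r' : R, 0 < t < t0 -> 0 <= r <= r' -> b t r' <= b t r.
Hypothesis PI : forall t u, 0 < t ->
  {ae mu, forall x, P t u x = heat_integral p t u x}.

Lemma heat_integralB t u v x : 0 < t < t0 ->
  heat_integral p t u x - heat_integral p t v x = heat_integral p t (u - v) x.
Proof.
move=> tt; have [k kE _] := kernel_section muT pP pb b_ge0 b_anti x tt.
have e w : heat_integral p t w x = dot k w.
  by apply: eq_Rintegral => y _; rewrite kE.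
by rewrite !e dotBr.
Qed.

Lemma heat_integral_rep t u : 0 < t < t0 -> exists w : L2 mu,
  [/\ (w : X -> R) = heat_integral p t u, continuous (w : X -> R) &
    w = P t u %[ae mu]].
Proof.
move=> tt; have [t1 _] := andP tt.
have [w wE] := heat_integral_L2 muT pP pb b_ge0 b_anti u tt.
exists w; split => //.
  by rewrite wE; exact: (heat_integral_continuous muT pP pb b_ge0 b_anti tt).
by apply: ae_mono (PI u t1) => x e _; rewrite wE e.
Qed.

(** Half of the heat flow turns the convergence in L^2 of the difference
    quotients at time t / 2 into a uniform convergence, whose limit is the image
    of P_t u under the generator. *)
Lemma heat_domain t u : 0 < t < t0 ->
  exists2 w, A (P t u) w & norm2 w <= t^-1 * norm2 u.
Proof.
move=> /andP[t1 tt0]; set s := t / 2.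
have s1 : 0 < s by rewrite /s divr_gt0.
have ss : 0 < s < t0 by rewrite s1/= (lt_trans _ tt0)// /s; lra.
have st : s + s = t by rewrite /s; lra.
pose h_ n : R := n.+1%:R^-1.
have h0 n : 0 < h_ n by rewrite invr_gt0.
have hh : h_ @ \oo --> (0 : R) by exact: cvg_harmonic.
have [G GE] := choice (fun n => heat_integral_rep (heat_quotient P s (h_ n) u) ss).
pose c := b s 0 * sqrt_mass mu * (4 / s ^+ 2 * 2 * norm2 u).
have c0 : 0 <= b s 0 * sqrt_mass mu by rewrite mulr_ge0 ?b_ge0// sqrt_mass_ge0.
have [||m n x mn|g cg gG] := @uniform_cauchy_limit _ X (fun n => G n : X -> R)
    (fun n => c * h_ n).
- by move=> n; have [_ + _] := GE n.
- by rewrite -(mulr0 c); exact: cvgMr.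
- have [-> _ _] := GE n; have [-> _ _] := GE m.
  rewrite heat_integralB// (le_trans (heat_integral_bound muT pP pb b_ge0 b_anti _ x ss))//.
  rewrite /c -[leRHS]mulrA ler_wpM2l//.
  rewrite (le_trans (heat_quotientB_norm PE u s1 (h0 n) (h0 m)))//.
  have hnm : h_ n <= h_ m by rewrite /h_ lef_pV2 ?posrE// ler_nat.
  have u0 := norm2_ge0 u.
  have c4 : 0 <= 4 / s ^+ 2 by rewrite divr_ge0 ?sqr_ge0.
  have -> : 4 / s ^+ 2 * 2 * norm2 u * h_ m
    = 4 / s ^+ 2 * (h_ m + h_ m) * norm2 u by ring.
  by rewrite ler_wpM2r// ler_wpM2l// lerD2r.
have [w wE] : exists w : L2 mu, (w : X -> R) = g.
  apply: (bounded_L2 muT); first exact: continuous_borel.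
  exists (b s 0 * sqrt_mass mu * norm2 (heat_quotient P s (h_ 0%N) u)
          + c * h_ 0%N) => x.
  have [G0 _ _] := GE 0%N.
  rewrite -(subrK (G 0%N x) (g x)) addrC (le_trans (ler_normD _ _))// lerD//.
  by rewrite G0; exact: (heat_integral_bound muT pP pb b_ge0 b_anti _ x ss).
have Gw : cvg2 G w.
  apply: (@uniform_cvg2 _ _ (fun n => c * h_ n)).
    by move=> n x; rewrite wE.
  by rewrite -(mulr0 c); exact: cvgMr.
have quot n : G n = heat_quotient P t (h_ n) u %[ae mu].
  have [_ _ e] := GE n; apply: (ae_eq_trans e).
  have sg r : 0 < r -> P s (P r u) = P (s + r) u %[ae mu].
    exact: (heat_semigroup PE u s1).
  have sh0 : 0 < s + h_ n by exact: addr_gt0.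
  apply: dot_ext => v; rewrite (heat_sym PE _ v s1) /heat_quotient.
  rewrite !dotZl !dotDl !dotZl -!(heat_sym PE _ v s1).
  rewrite (dot_ae (sg _ sh0) (ae_eq_refl _ _ _)).
  by rewrite (dot_ae (sg _ s1) (ae_eq_refl _ _ _)) addrA st.
have qw : cvg2 (fun n => heat_quotient P t (h_ n) u) w by exact: cvg2_ae quot Gw.
exists w; first exact: (heat_generator AE PE t1 h0 hh qw).
have : (fun n => t^-1 * norm2 u + norm2 (heat_quotient P t (h_ n) u - w)) @ \oo
    --> t^-1 * norm2 u + 0 by apply: cvgD; [exact: cvg_cst|exact: qw].
rewrite addr0 => lim; apply: (cvgr_to_ge lim); apply: nearW => n.
have {1}-> : w = heat_quotient P t (h_ n) u - (heat_quotient P t (h_ n) u - w).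
  by rewrite opprB addrC subrK.
rewrite (le_trans (ler_norm2D _ _))// norm2N lerD2r.
exact: (heat_quotient_norm PE u t1 (h0 n)).
Qed.

(** P_t is a product of two flows for the time t / 2: one makes room for one
    factor of the generator, the other for the k remaining ones. *)
Lemma heat_iter_domain k : exists2 C : R, 0 <= C & forall t u, 0 < t < t0 ->
  exists2 w, iter_operator A k (P t u) w & norm2 w <= C * t ^- k * norm2 u.
Proof.
elim: k => [|k [C C0 ih]].
  exists 1 => // t u /andP[t1 _]; exists (P t u); first exact: ae_eq_refl.
  by rewrite expr0 invr1 !mul1r; exact: (heat_contraction PE u t1).
exists (C * 2 ^+ k.+1) => [|t u /andP[t1 tt0]]; first by rewrite mulr_ge0// exprn_ge0.
have s1 : 0 < t / 2 by rewrite divr_gt0.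
have ss : 0 < t / 2 < t0 by rewrite s1/= (lt_trans _ tt0)//; lra.
have [z uz zn] := ih _ u ss.
have [w zw wn] := heat_domain z ss.
exists w.
  exists (P (t / 2) z) => //.
  apply: iter_operator_ae (ae_eq_refl _ _ _) (iter_operator_heat s1 uz).
  by have := heat_semigroup PE u s1 s1; rewrite -splitr.
rewrite (le_trans wn)//.
apply: (@le_trans _ _ ((t / 2)^-1 * (C * (t / 2) ^- k * norm2 u))).
  by rewrite ler_wpM2l// invr_ge0 ltW.
rewrite le_eqVlt; apply/orP; left; apply/eqP.
rewrite exprMn exprVn !invfM !invrK exprS [in RHS]exprS invfM; ring.
Qed.

Context (m : nat) (Cb : R).
Hypothesis b_poly : forall t, 0 < t < t0 -> b t 0 <= Cb * t ^- m.

(** With half of the time spent in the kernel, the bound of the previous lemma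
    becomes uniform, at the cost of the power of t that bounds the kernel on the
    diagonal. *)
Lemma heat_smoothing k : exists2 C : R, 0 <= C & forall t u, 0 < t < t0 ->
  exists w : L2 mu, [/\ iter_operator A k (P t u) w, continuous (w : X -> R) &
    forall x, `|w x| <= C * t ^- (k + m) * norm2 u].
Proof.
have [C C0 hC] := heat_iter_domain k.
have M0 : 0 <= sqrt_mass mu by exact: sqrt_mass_ge0.
exists (`|Cb| * sqrt_mass mu * C * 2 ^+ (k + m)) => [|t u /andP[t1 tt0]].
  by rewrite !mulr_ge0// exprn_ge0.
have s1 : 0 < t / 2 by rewrite divr_gt0.
have ss : 0 < t / 2 < t0 by rewrite s1/= (lt_trans _ tt0)//; lra.
have [z uz zn] := hC _ u ss.
have [w [wE cw wae]] := heat_integral_rep z ss.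
exists w; split => //.
  apply: iter_operator_ae (ae_eq_sym wae) (iter_operator_heat s1 uz).
  by have := heat_semigroup PE u s1 s1; rewrite -splitr.
move=> x; rewrite wE.
rewrite (le_trans (heat_integral_bound muT pP pb b_ge0 b_anti _ x ss))//.
have z0 := norm2_ge0 z; have s0 : 0 <= (t / 2) ^- m by rewrite invr_ge0 exprn_ge0// ltW.
apply: (@le_trans _ _ (`|Cb| * (t / 2) ^- m * sqrt_mass mu * norm2 z)).
  rewrite ler_wpM2r// ler_wpM2r// (le_trans (b_poly ss))// ler_wpM2r//.
  exact: ler_norm.
apply: (@le_trans _ _ (`|Cb| * (t / 2) ^- m * sqrt_mass mu *
    (C * (t / 2) ^- k * norm2 u))).
  by rewrite ler_wpM2l// !mulr_ge0.
rewrite le_eqVlt; apply/orP; left; apply/eqP.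
rewrite !exprMn !exprVn !invfM !invrK !exprD invfM; ring.
Qed.

(** A sum of images under the heat flow is smooth as soon as the norms of the
    data decrease fast enough relative to the times: every power of the
    generator may be summed term by term, uniformly. *)
Lemma smooth_heat_series (s_ : nat -> R) (e_ : nat -> L2 mu) :
  (forall n, 0 < s_ n < t0) ->
  (forall k, exists B : R, forall n,
     \sum_(0 <= i < n) (s_ i ^- k * norm2 (e_ i)) <= B) ->
  exists (W : nat -> L2 mu) (F_ : nat -> L2 mu) (r_ : nat -> R),
  [/\ forall k, continuous (W k : X -> R) /\ iter_operator A k (W 0%N) (W k),
      forall n, continuous (F_ n : X -> R) /\
        F_ n = \sum_(0 <= i < n) P (s_ i) (e_ i) %[ae mu],
      r_ @ \oo --> (0 : R) & forall n x, `|W 0%N x - F_ n x| <= r_ n].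
Proof.
move=> ss sB; pose S n : L2 mu := \sum_(0 <= i < n) P (s_ i) (e_ i).
have exC k : exists C, 0 <= C /\
    forall t u, 0 < t < t0 -> exists w : L2 mu,
      [/\ iter_operator A k (P t u) w, continuous (w : X -> R) &
        forall x, `|w x| <= C * t ^- (k + m) * norm2 u].
  by have [C C0 h] := heat_smoothing k; exists C.
have [C hC] := choice exC.
have exw (kn : nat * nat) : exists w : L2 mu,
    [/\ iter_operator A kn.1 (P (s_ kn.2) (e_ kn.2)) w,
      continuous (w : X -> R) &
      forall x, `|w x| <= C kn.1 * s_ kn.2 ^- (kn.1 + m) * norm2 (e_ kn.2)].
  by case: kn => k n; have [_ h] := hC k; exact: h.
have [w hw] := choice exw.
pose Wn k n : L2 mu := \sum_(0 <= i < n) w (k, i).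
have WnS k n : Wn k n.+1 = Wn k n + w (k, n) by rewrite /Wn big_nat_recr.
have Wn0 k : Wn k 0%N = 0 by rewrite /Wn big_geq.
have cWn k n : continuous (Wn k n : X -> R).
  elim: n => [|n ih]; first by rewrite Wn0; exact: cst_continuous.
  have [_ cw _] := hw (k, n).
  by rewrite WnS => x; apply: cvgD; [exact: ih|exact: cw].
have iWn k n : iter_operator A k (S n) (Wn k n).
  elim: n => [|n ih]; first by rewrite Wn0 /S big_geq//; exact: iter_operator0.
  have [iw _ _] := hw (k, n).
  by rewrite WnS /S big_nat_recr//=; exact: iter_operatorD.
have AWn k n : A (Wn k n) (Wn k.+1 n).
  have [z Sz zW] := iWn k.+1 n.
  apply: operator_ae A_lin _ _ _ _ _ (ae_eq_refl _ _ _) zW.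
  exact: iter_operator_uniq Sz (iWn k n).
have exg k : exists g r_, [/\ continuous g,
    r_ @ \oo --> (0 : R) & forall n x, `|g x - Wn k n x| <= r_ n].
  have [B hB] := sB (k + m)%N; have [Ck _] := hC k.
  apply: (@uniform_series_limit _ X (fun n => Wn k n : X -> R)
    (fun n => C k * (s_ n ^- (k + m) * norm2 (e_ n))) (C k * B)) => //.
  - move=> n; have /andP[s0 _] := ss n.
    by rewrite !mulr_ge0 ?norm2_ge0// invr_ge0 exprn_ge0// ltW.
  - move=> n x; have [_ _ wb] := hw (k, n).
    have -> : Wn k n.+1 x - Wn k n x = w (k, n) x.
      by rewrite WnS [X in X - _]/(Wn k n x + w (k, n) x) addrC addKr.
    by rewrite mulrA; exact: wb.
  - by move=> n; rewrite -mulr_sumr ler_wpM2l.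
have [g hg] := choice exg.
have exW k : exists W : L2 mu, (W : X -> R) = g k.
  have [r_ [cg _ gr]] := hg k.
  apply: (bounded_L2 muT); first exact: continuous_borel.
  exists (r_ 0%N) => x; have := gr 0%N x.
  by rewrite Wn0 [X in _ - X]/(0 : R) subr0.
have [W hW] := choice exW.
have AW k : A (W k) (W k.+1).
  have [r [_ r0 gr]] := hg k; have [r' [_ r0' gr']] := hg k.+1.
  apply: (operator_closed saA (AWn k)).
    by apply: (uniform_cvg2 _ r0) => n x; rewrite hW.
  by apply: (uniform_cvg2 _ r0') => n x; rewrite hW.
have [r [_ r0 gr]] := hg 0%N.
exists W, (Wn 0%N), r; split => //.
- move=> k; split; first by rewrite hW; have [? []] := hg k.
  by elim: k => [|k ih]; [exact: ae_eq_refl|exists (W k)].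
- by move=> n; split => //; apply: ae_eq_sym; exact: (iWn 0%N n).
- by move=> n x; rewrite hW.
Qed.

End Smoothing.

(** * Cutting off *)

Section Cutoff.
Context {R : realType} {X : pmetricType R}.
Context {mu : {measure set (borel X) -> \bar R}}.
Context (muT : (mu setT < +oo)%E).
Context (A : operator mu) (E : proj_measure mu) (P : R -> L2 mu -> L2 mu).
Hypothesis AE : spectral_resolution A E.
Hypothesis PE : heat_operators E P.
Hypothesis markovP : markov_operators P.
Context (one : L2 mu) (oneE : (one : X -> R) = cst 1).
Hypothesis A1 : A one 0.
Implicit Types (f g u v w : L2 mu) (t : R).

Let M := sqrt_mass mu.

Lemma ess_support_sub f (C : set X) : closed C -> (forall x, ~ C x -> f x = 0) ->
  ess_support f `<=` C.
Proof.
move=> cC fC x fx; apply: contrapT => Cx; apply: fx; exists (~` C); split => //.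
  exact: closed_openC.
by apply: aeW => y Cy; exact: fC.
Qed.

Lemma ess_supportZ a f : ess_support (a *: f) `<=` ess_support f.
Proof.
move=> x ax [U [oU Ux f0]]; apply: ax; exists U; split => //.
apply: ae_mono f0 => y fy Uy; have -> : (a *: f) y = a * f y by [].
by rewrite (fy Uy) mulr0.
Qed.

Lemma L2_sqr_integrable w : mu.-integrable setT (EFin \o (fun x => w x ^+ 2)).
Proof.
have -> : (fun x => w x ^+ 2) = (fun x => w x * w x).
  by apply/funext => x; rewrite expr2.
exact: dot_integrable.
Qed.

Lemma Rintegral_sqr_le_dot w (L : set (borel X)) : measurable L ->
  \int[mu]_(x in L) (w x) ^+ 2 <= dot w w.
Proof.
move=> mL; rewrite Rintegral_mkcond; apply: le_Rintegral => //.
- rewrite -restrict_EFin; apply/(integrable_mkcond _ mL).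
  exact: integrableS (L2_sqr_integrable w).
- exact: dot_integrable.
move=> x _; rewrite patchE; case: ifPn => _; first by rewrite expr2.
by rewrite -expr2 sqr_ge0.
Qed.

Lemma Rintegral_sqr_ae u w (L : set (borel X)) : measurable L ->
  u = w %[ae mu] ->
  \int[mu]_(x in L) (u x) ^+ 2 = \int[mu]_(x in L) (w x) ^+ 2.
Proof.
move=> mL uw; congr fine; apply: ae_eq_integral => //.
- by apply: (measurable_int mu); apply: integrableS (L2_sqr_integrable u).
- by apply: (measurable_int mu); apply: integrableS (L2_sqr_integrable w).
by apply: ae_mono uw => x + _ => ->.
Qed.

(** The supremum defining D(t, d) ranges over unit vectors only; by homogeneity
    it controls all of L^2. *)
Lemma heat_decay_bound t d f (L : set (borel X)) : 0 < t -> measurable L ->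
  dist_ge (ess_support f) L d ->
  \int[mu]_(x in L) (P t f x) ^+ 2 <= heat_decay P t d ^+ 2 * norm2 f ^+ 2.
Proof.
move=> t0 mL fL.
have Pn := heat_contraction PE f t0.
have PPf : dot (P t f) (P t f) <= norm2 f ^+ 2.
  by rewrite -norm2_sqr ler_pXn2r// nnegrE norm2_ge0.
have [f0|f0] := eqVneq (norm2 f) 0.
  rewrite f0 expr0n mulr0; rewrite f0 expr0n in PPf.
  exact: le_trans (Rintegral_sqr_le_dot _ mL) PPf.
rewrite /heat_decay; set E0 := [set r | _].
have ubE : has_ubound E0.
  exists 1 => r [g [L' [g1 mL' _ ->]]].
  have : dot (P t g) (P t g) <= 1.
    rewrite -norm2_sqr -[leRHS]g1 ler_pXn2r// ?nnegrE ?norm2_ge0//.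
    exact: (heat_contraction PE g t0).
  exact: le_trans (Rintegral_sqr_le_dot _ mL').
pose g : L2 mu := (norm2 f)^-1 *: f.
have fi0 : 0 <= (norm2 f)^-1 by rewrite invr_ge0 norm2_ge0.
have g1 : norm2 g ^+ 2 = 1.
  by rewrite norm2Z ger0_norm// mulVf// expr1n.
have Pg : P t g = (norm2 f)^-1 *: P t f %[ae mu].
  apply: dot_ext => v.
  by rewrite (heat_sym PE g v t0) !dotZl (heat_sym PE f v t0).
have gE : E0 (\int[mu]_(x in L) (P t g x) ^+ 2).
  exists g, L; split => // x y gx Ly; apply: fL => //; exact: ess_supportZ gx.
have E0_ge0 : 0 <= sup E0.
  apply: le_trans (ub_le_sup ubE gE).
  by apply: Rintegral_ge0 => x _; exact: sqr_ge0.
rewrite sqr_sqrtr// -ler_pdivrMr; last first.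
  by rewrite exprn_gt0// lt_neqAle eq_sym f0 norm2_ge0.
apply: le_trans (ub_le_sup ubE gE).
rewrite (Rintegral_sqr_ae mL Pg) mulrC -RintegralZl//; last first.
  exact: integrableS (L2_sqr_integrable (P t f)).
rewrite le_eqVlt; apply/orP; left; apply/eqP; apply: eq_Rintegral => x _.
by rewrite -exprVn -exprMn.
Qed.

Context (delta : X -> R).
Hypothesis delta_lip : forall x y, `|delta x - delta y| <= mdist x y.

Lemma lipschitz_continuous : continuous delta.
Proof.
apply: sequentially_continuous => x x_ xx; apply/cvgrPdist_le => e e0.
move/cvgr0Pnorm_le : xx => /(_ e e0); apply: filterS => n.
by rewrite ger0_norm ?mdist_ge0// => h; exact: le_trans (delta_lip _ _) h.
Qed.

Let closed_le (r : R) : closed [set x | delta x <= r].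
Proof.
rewrite (_ : mkset _ = delta @^-1` `]-oo, r]%classic).
  apply: preimage_closed; first by move=> x _; exact: lipschitz_continuous.
  exact: interval_closed.
by apply/seteqP; split => x; rewrite /= in_itv.
Qed.

Let closed_ge (r : R) : closed [set x | r <= delta x].
Proof.
rewrite (_ : mkset _ = delta @^-1` `[r, +oo[%classic).
  apply: preimage_closed; first by move=> x _; exact: lipschitz_continuous.
  exact: interval_closed.
by apply/seteqP; split => x; rewrite /= in_itv/= andbT.
Qed.

Definition cutoff_profile (l m : R) f := [/\ forall x, 0 <= f x <= 1,
  forall x, m < delta x -> f x = 0 & forall x, delta x < l -> f x = 1].

Lemma cutoff_profile_norm l m f : cutoff_profile l m f -> norm2 f <= M.
Proof.
case=> f01 _ _; rewrite -[leRHS]mul1r; apply: (norm2_bounded muT) => x.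
by have /andP[h0 h1] := f01 x; rewrite ger0_norm.
Qed.

Lemma heat_one_sub t f : 0 < t ->
  {ae mu, forall x, P t (one - f) x = 1 - P t f x}.
Proof.
move=> t0; have h : P t (one - f) = P t one - P t f %[ae mu].
  apply: dot_ext => v; rewrite (heat_sym PE _ v t0) !dotBl.
  by rewrite (heat_sym PE one v t0) (heat_sym PE f v t0).
have h1 := heat_one AE PE oneE A1 t0.
apply: ae_mono (ae_and h h1) => x [+ P1] => /(_ I) ->.
by rewrite [LHS]/(P t one x - P t f x) P1.
Qed.

(** Resetting P_t f to 1 and 0 at distance d from where f is not 1 and not 0 is
    a small change: where f is 0 this is the definition of D(t, d), and where f
    is 1 the same applies to 1 - f, because P_t 1 = 1. *)
Lemma cutoff_step t d (l l' m m' : R) f : 0 < t -> l' + d <= l -> m + d <= m' ->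
  l' <= m' -> cutoff_profile l m f ->
  exists2 f', cutoff_profile l' m' f' &
    norm2 (f' - P t f) <= 2 * heat_decay P t d * M.
Proof.
move=> t0 ll mm lm pf; have [f01 fm fl] := pf.
pose outer : set (borel X) := [set x | m' < delta x].
pose inner : set (borel X) := [set x | delta x < l'].
have mO : measurable outer.
  rewrite (_ : outer = ~` [set x | delta x <= m']).
    by apply: measurableC; exact: closed_borel.
  by apply/seteqP; split => x; rewrite /outer/= ltNge => /negP.
have mI : measurable inner.
  rewrite (_ : inner = ~` [set x | l' <= delta x]).
    by apply: measurableC; exact: closed_borel.
  by apply/seteqP; split => x; rewrite /inner/= ltNge => /negP.
pose clamp x := Num.min (Num.max (P t f x) 0) 1.
have clamp01 x : 0 <= clamp x <= 1.
  by rewrite /clamp ge_min lexx orbT le_min le_max lexx orbT ler01.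
pose h x := \1_inner x + \1_(~` (outer `|` inner)) x * clamp x.
have inO x : (x \in outer) = (m' < delta x) by apply/idP/idP; rewrite inE.
have inI x : (x \in inner) = (delta x < l') by apply/idP/idP; rewrite inE.
have hE x : h x = if m' < delta x then 0 else if delta x < l' then 1 else clamp x.
  rewrite /h !indicE in_setC in_setU inO inI.
  have [xm|xm] := ltP m' (delta x).
    by rewrite ltNge (le_trans lm (ltW xm))/= mul0r addr0.
  by case: ifPn => _ /=; rewrite ?mul0r ?mul1r ?addr0 ?add0r.
have h1 x : m' < delta x -> h x = 0 by move=> xm; rewrite hE xm.
have h2 x : delta x < l' -> h x = 1.
  by move=> xl; rewrite hE xl ltNge (le_trans (ltW xl) lm).
have h3 x : l' <= delta x <= m' -> h x = clamp x.
  by move=> /andP[xl xm]; rewrite hE !ltNge xl xm.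
have [f' f'E] : exists f' : L2 mu, (f' : X -> R) = h.
  apply: (bounded_L2 muT).
    apply: measurable_funD; first exact: measurable_indic.
    apply: measurable_funM.
      by apply: measurable_indic; apply: measurableC; exact: measurableU.
    by apply: measurable_minr => //; apply: measurable_maxr => //.
  exists 1 => x; have [xl|xl] := ltP (delta x) l'; first by rewrite h2// normr1.
  have [xm|xm] := ltP m' (delta x); first by rewrite h1// normr0.
  rewrite h3 ?xl//; have /andP[c0 c1] := clamp01 x; by rewrite ger0_norm.
exists f'.
  split=> x; rewrite f'E.
  - have [xl|xl] := ltP (delta x) l'; first by rewrite h2// ler01 lexx.
    have [xm|xm] := ltP m' (delta x); first by rewrite h1// ler01 lexx.
    by rewrite h3 ?xl.
  - exact: h1.
  - exact: h2.
have D0 : 0 <= heat_decay P t d by exact: sqrtr_ge0.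
have M0 : 0 <= M by exact: sqrt_mass_ge0.
have fM := cutoff_profile_norm pf.
have ofM : norm2 (one - f) <= M.
  rewrite -[leRHS]mul1r; apply: (norm2_bounded muT) => x.
  have -> : (one - f) x = 1 - f x by rewrite [LHS]/(one x - f x) oneE.
  by have /andP[a0 a1] := f01 x; rewrite ger0_norm ?subr_ge0// lerBlDr lerDl.
have sf : ess_support f `<=` [set x | delta x <= m].
  apply: ess_support_sub => [|z /= /negP]; first exact: closed_le.
  by rewrite -ltNge; exact: fm.
have sof : ess_support (one - f) `<=` [set x | l <= delta x].
  apply: ess_support_sub => [|z /= /negP]; first exact: closed_ge.
  rewrite -ltNge => /fl fz.
  transitivity (one z - f z); first by [].
  by rewrite fz oneE; exact: subrr.
have b1 : \int[mu]_(x in outer) (P t f x) ^+ 2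
    <= heat_decay P t d ^+ 2 * norm2 f ^+ 2.
  apply: heat_decay_bound => // x y /sf /= fx; rewrite /outer/= => yL.
  apply: le_trans (delta_lip x y); rewrite distrC.
  by apply: le_trans (ler_norm _); lra.
have b2 : \int[mu]_(x in inner) (P t (one - f) x) ^+ 2
    <= heat_decay P t d ^+ 2 * norm2 (one - f) ^+ 2.
  apply: heat_decay_bound => // x y /sof /= fx; rewrite /inner/= => yL.
  apply: le_trans (delta_lip x y).
  by apply: le_trans (ler_norm _); lra.
apply: norm2_le; first by rewrite !mulr_ge0.
have -> : dot (f' - P t f) (f' - P t f) = \int[mu]_(x in outer) (P t f x) ^+ 2
    + \int[mu]_(x in inner) (P t (one - f) x) ^+ 2.
  rewrite (Rintegral_mkcond _ outer) (Rintegral_mkcond _ inner).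
  rewrite -RintegralD//; last 2 first.
  - rewrite -restrict_EFin; apply/(integrable_mkcond _ mO).
    exact: integrableS (L2_sqr_integrable _).
  - rewrite -restrict_EFin; apply/(integrable_mkcond _ mI).
    exact: integrableS (L2_sqr_integrable _).
  congr fine; apply: ae_eq_integral => //.
  - exact: measurable_int (dot_integrable (f' - P t f) (f' - P t f)).
  - apply/measurable_EFinP; apply: measurable_funD.
      apply/(measurable_restrictT _ mO); apply: measurable_funTS.
      by apply: measurable_funX; exact: L2_measurable.
    apply/(measurable_restrictT _ mI); apply: measurable_funTS.
    by apply: measurable_funX; exact: L2_measurable.
  have P01 : {ae mu, forall x, 0 <= P t f x <= 1}.
    by apply: markovP => //; exact: aeW.
  apply: ae_mono (ae_and P01 (heat_one_sub f t0)) => x [/andP[p0 p1] px] _ /=.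
  congr EFin; rewrite !patchE px.
  transitivity ((h x - P t f x) * (h x - P t f x)); first by rewrite -f'E.
  rewrite inO inI hE; have [xm|xm] := ltP m' (delta x).
    by rewrite ltNge (le_trans lm (ltW xm))/= addr0 sub0r expr2 mulrNN.
  case: ifPn => _; first by rewrite add0r expr2.
  by rewrite /clamp max_l// min_l// subrr mul0r addr0.
have := norm2_ge0 f; have := norm2_ge0 (one - f) => of0 f0.
have f2 : norm2 f ^+ 2 <= M ^+ 2 by rewrite ler_pXn2r ?nnegrE.
have of2 : norm2 (one - f) ^+ 2 <= M ^+ 2 by rewrite ler_pXn2r ?nnegrE.
have D2 := sqr_ge0 (heat_decay P t d).
apply: le_trans (lerD b1 b2) _.
apply: le_trans (lerD (ler_wpM2l D2 f2) (ler_wpM2l D2 of2)) _.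
rewrite !exprMn; have := mulr_ge0 D2 (sqr_ge0 M); lra.
Qed.

End Cutoff.

(** * The limit of the cut-offs *)

Section CutoffLimit.
Context {R : realType} {X : pmetricType R}.
Context {mu : {measure set (borel X) -> \bar R}}.
Context (muT : (mu setT < +oo)%E).
Context (A : operator mu) (E : proj_measure mu) (P : R -> L2 mu -> L2 mu).
Hypothesis saA : self_adjoint A.
Hypothesis AE : spectral_resolution A E.
Hypothesis PE : heat_operators E P.
Hypothesis markovP : markov_operators P.
Context (one : L2 mu) (oneE : (one : X -> R) = cst 1).
Hypothesis A1 : A one 0.
Context (p : R -> X -> X -> R) (t0 : R) (t0_gt0 : 0 < t0).
Hypothesis pP : continuous_heat_kernel P p.
Context (b : R -> R -> R).
Hypothesis pb : forall (t : R) x y, 0 < t < t0 -> p t x y <= b t (mdist x y).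
Hypothesis b_ge0 : forall t r : R, 0 < t < t0 -> 0 <= b t r.
Hypothesis b_anti : forall t r r' : R, 0 < t < t0 -> 0 <= r <= r' -> b t r' <= b t r.
Hypothesis b_cvg : forall (r : R) (t_ : nat -> R), 0 < r ->
  (forall n, 0 < t_ n < t0) -> t_ @ \oo --> (0 : R) ->
  (fun n => b (t_ n) r) @ \oo --> (0 : R).
Context (m : nat) (Cb : R).
Hypothesis b_poly : forall t : R, 0 < t < t0 -> b t 0 <= Cb * t ^- m.
Context (delta : X -> R).
Hypothesis delta_lip : forall x y, `|delta x - delta y| <= mdist x y.
Context (r : R) (r_gt0 : 0 < r).
Context (a_ d_ s_ : nat -> R).
Hypothesis a_gt0 : forall n, 0 < a_ n.
Hypothesis d_ge0 : forall n, 0 <= d_ n.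
Hypothesis d_sum : forall n, \sum_(0 <= i < n) d_ i <= r / 4.
Hypothesis s_rec : forall n, s_ n = a_ n + s_ n.+1.
Hypothesis s_bnd : forall n, 0 < s_ n < t0.
Hypothesis s_cvg : s_ @ \oo --> (0 : R).
Hypothesis decay : forall k, exists B : R, forall n,
  \sum_(0 <= i < n) (a_ i.+1 ^- k * heat_decay P (a_ i) (d_ i)) <= B.

Let M := sqrt_mass mu.
Let l_ n := r / 2 - \sum_(0 <= i < n) d_ i.
Let m_ n := r / 2 + \sum_(0 <= i < n) d_ i.

Let s0 n : 0 < s_ n. Proof. by have /andP[] := s_bnd n. Qed.

(** The region where f_n is 1 shrinks and the region where it is not 0 grows by
    the distance d_n at step n; since these distances add up to at most r / 4,
    they stay within r / 4 and 3 r / 4. *)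
Lemma cutoff_sequence : exists f_ : nat -> L2 mu,
  forall n, cutoff_profile delta (l_ n) (m_ n) (f_ n) /\
    norm2 (f_ n.+1 - P (a_ n) (f_ n)) <= 2 * heat_decay P (a_ n) (d_ n) * M.
Proof.
have sd n : \sum_(0 <= i < n.+1) d_ i = \sum_(0 <= i < n) d_ i + d_ n.
  by rewrite big_nat_recr.
have d0 n : 0 <= \sum_(0 <= i < n) d_ i by exact: sumr_ge0.
have step (nf : nat * L2 mu) : exists f',
    cutoff_profile delta (l_ nf.1) (m_ nf.1) nf.2 ->
    cutoff_profile delta (l_ nf.1.+1) (m_ nf.1.+1) f' /\
    norm2 (f' - P (a_ nf.1) nf.2) <= 2 * heat_decay P (a_ nf.1) (d_ nf.1) * M.
  case: nf => n f /=.
  have [pf|npf] := pselect (cutoff_profile delta (l_ n) (m_ n) f); last by exists f.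
  have := d0 n; have := d_ge0 n => dn sn.
  have [|||f' pf' fn] := cutoff_step muT AE PE markovP oneE A1 delta_lip
    (d := d_ n) (l' := l_ n.+1) (m' := m_ n.+1) (a_gt0 n) _ _ _ pf.
  - by rewrite /l_ sd; lra.
  - by rewrite /m_ sd; lra.
  - by rewrite /l_ /m_ sd; lra.
  by exists f'.
have [st hst] := choice step.
have mC : measurable ([set x | delta x <= r / 2] : set (borel X)).
  rewrite (_ : mkset _ = ~` [set x | r / 2 < delta x]).
    apply: measurableC; apply: open_borel.
    rewrite (_ : mkset _ = delta @^-1` `]r / 2, +oo[%classic).
      by move/continuousP : (lipschitz_continuous delta_lip); apply; exact: interval_open.
    by apply/seteqP; split => x; rewrite /= in_itv/= andbT.
  by apply/seteqP; split => x /=; rewrite leNgt => /negP.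
have [f0 f0E] : exists f : L2 mu, (f : X -> R) = \1_[set x | delta x <= r / 2].
  apply: (bounded_L2 muT); first exact: (@measurable_indic _ (borel X)).
  by exists 1 => z; rewrite indicE; case: (_ \in _); rewrite ?normr1 ?normr0.
pose f_ := fix f_ n := if n is n'.+1 then st (n', f_ n') else f0.
have pf n : cutoff_profile delta (l_ n) (m_ n) (f_ n).
  elim: n => [|n ih]; last exact: (hst (n, f_ n) ih).1.
  rewrite /l_ /m_ big_geq// subr0 addr0.
  have fE x : f_ 0%N x = if delta x <= r / 2 then 1 else 0.
    rewrite /= f0E indicE (_ : (x \in _) = (delta x <= r / 2)).
      by case: ifP.
    by apply/idP/idP; rewrite inE.
  split=> x; rewrite fE.
  - by case: ifP => _; rewrite ?lexx ?ler01.
  - by move=> xr; rewrite leNgt xr.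
  - by move=> xr; rewrite ltW.
by exists f_ => n; split; [exact: pf|exact: (hst (n, f_ n) (pf n)).2].
Qed.

Let PI t u : 0 < t -> {ae mu, forall x, P t u x = heat_integral p t u x} :=
  @heat_integralE _ _ _ muT _ _ _ AE PE markovP _ oneE A1 _ _ t0_gt0 pP _ pb
    b_anti b_cvg t u.

(** P_(s_n) f_n telescopes into P_(s_0) f_0 plus the sum of the P_(s_(j+1)) e_j,
    where e_j = f_(j+1) - P_(a_j) f_j is the change made by a cut-off. Since
    s_(j+1) >= a_(j+1) and e_j is controlled by D(a_j, d_j), this series has a
    smooth sum. Its values are found from the kernel: the functions f_n stay at
    distance r / 4 from the points considered, and s_n tends to 0. *)
Lemma cutoff_limit : exists W : nat -> L2 mu,
  (forall k, continuous (W k : X -> R) /\ iter_operator A k (W 0%N) (W k)) /\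
  forall x, measure_support mu x -> [/\ 0 <= W 0%N x <= 1,
    delta x <= 0 -> W 0%N x = 1 & r <= delta x -> W 0%N x = 0].
Proof.
have [f_ hf] := cutoff_sequence.
have M0 : 0 <= M by exact: sqrt_mass_ge0.
pose e_ n := if n is n'.+1 then f_ n'.+1 - P (a_ n') (f_ n') else f_ 0%N.
have sume n : \sum_(0 <= i < n.+1) P (s_ i) (e_ i) = P (s_ n) (f_ n) %[ae mu].
  elim: n => [|n ih]; first by rewrite big_nat1; exact: ae_eq_refl.
  rewrite big_nat_recr//=; apply: ae_eq_trans (aeD ih (ae_eq_refl _ _ _)) _.
  apply: dot_ext => v; rewrite dotDl !(heat_sym PE _ v (s0 _)).
  rewrite dotBl -!(heat_sym PE _ v (s0 _)).
  have sg := heat_semigroup PE (f_ n) (s0 n.+1) (a_gt0 n).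
  rewrite (dot_ae sg (ae_eq_refl _ _ _)) addrC (addrC (s_ n.+1)) -s_rec.
  by rewrite subrK.
have fM n : norm2 (f_ n) <= M := cutoff_profile_norm muT (hf n).1.
have [k|W [F_ [r_ [hW hF r0 WF]]]] := smooth_heat_series muT saA AE PE pP pb
    b_ge0 b_anti PI b_poly s_bnd (e_ := e_).
  have [B hB] := decay k.
  have D0 i : 0 <= heat_decay P (a_ i) (d_ i) by exact: sqrtr_ge0.
  have B0 : 0 <= B by have := hB 0%N; rewrite big_geq.
  exists (s_ 0%N ^- k * norm2 (e_ 0%N) + 2 * M * B) => -[|n].
    rewrite big_geq// addr_ge0 ?mulr_ge0 ?norm2_ge0// invr_ge0 exprn_ge0//.
    by rewrite ltW.
  rewrite big_nat_recl// lerD2l.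
  apply: le_trans (ler_wpM2l _ (hB n)); last by rewrite mulr_ge0.
  rewrite mulr_sumr; apply: ler_sum => i _.
  have as_ : a_ i.+1 <= s_ i.+1 by rewrite s_rec lerDl ltW.
  have ai : 0 < a_ i.+1 ^+ k by exact: exprn_gt0.
  have si : 0 < s_ i.+1 ^+ k by exact: exprn_gt0.
  have sak : s_ i.+1 ^- k <= a_ i.+1 ^- k.
    rewrite lef_pV2 ?posrE//; apply: lerXn2r => //.
      by rewrite nnegrE ltW.
    by rewrite nnegrE ltW.
  apply: (@le_trans _ _ (a_ i.+1 ^- k * (2 * heat_decay P (a_ i) (d_ i) * M))).
    apply: ler_pM => //; first by rewrite invr_ge0 ltW.
      exact: norm2_ge0.
    exact: (hf i).2.
  by rewrite le_eqVlt; apply/orP; left; apply/eqP; ring.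
exists W; split => // x Sx.
have cI n w := heat_integral_continuous muT pP pb b_ge0 b_anti (f := w) (s_bnd n).
have FI k : F_ k.+1 x = heat_integral p (s_ k) (f_ k) x.
  have [cF Fe] := hF k.+1.
  apply: (continuous_ae_eq cF (cI k (f_ k)) _ Sx).
  apply: ae_mono (ae_and (ae_and Fe (sume k)) (PI (f_ k) (s0 k))) => y.
  by move=> [[e1 e2] <-]; rewrite (e1 I) (e2 I).
have lim : (fun n => heat_integral p (s_ n) (f_ n) x) @ \oo --> W 0%N x.
  apply/cvgrPdist_le => e e0.
  move/cvgr0Pnorm_le : r0 => /(_ e e0) [N _ hN].
  exists N => // n /= Nn; rewrite -FI; apply: le_trans (WF _ x) _.
  by apply: le_trans (ler_norm _) _; apply: hN => /=; exact: leqW.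
have I1 n : heat_integral p (s_ n) (one - f_ n) x
    = 1 - heat_integral p (s_ n) (f_ n) x.
  rewrite -(heat_integralB muT pP pb b_ge0 b_anti) ?s_bnd//.
  by rewrite (heat_integral_one muT AE PE markovP oneE A1 t0_gt0 pP pb b_ge0
    b_anti b_cvg (s_bnd n) Sx).
have oneB n y : (one - f_ n) y = 1 - f_ n y.
  by transitivity (one y - f_ n y); last by rewrite oneE.
have f01 n y : 0 <= f_ n y <= 1 by have [[h _ _] _] := hf n.
have far (w : L2 mu) n : (forall y, 0 <= w y <= 1) ->
    (forall y, mdist x y < r / 4 -> w y = 0) ->
    `|heat_integral p (s_ n) w x| <= M ^+ 2 * b (s_ n) (r / 4).
  move=> w01 wr; apply: (heat_integral_far muT pP pb b_ge0 b_anti) => //.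
    by rewrite divr_ge0// ltW.
  by move=> y; have /andP[w0 w1] := w01 y; rewrite ger0_norm.
have bcvg : (fun n => M ^+ 2 * b (s_ n) (r / 4)) @ \oo --> (0 : R).
  rewrite -(mulr0 (M ^+ 2)); apply: cvgMr; apply: b_cvg => //.
  by rewrite divr_gt0.
have lipxy y : mdist x y < r / 4 ->
    delta x - delta y < r / 4 /\ delta y - delta x < r / 4.
  by move=> /(le_lt_trans (delta_lip x y)); rewrite ltr_norml => /andP[? ?]; lra.
split.
- apply/andP; split.
    apply: (cvgr_to_ge lim); apply: nearW => n; apply: heat_integral_ge0 => y.
    by have /andP[] := f01 n y.
  apply: (cvgr_to_le lim); apply: nearW => n; rewrite -subr_ge0 -I1.
  apply: heat_integral_ge0 => y; rewrite oneB subr_ge0.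
  by have /andP[] := f01 n y.
- move=> x0; have : (fun n => 1 - heat_integral p (s_ n) (f_ n) x) @ \oo --> (0 : R).
    apply: (@squeeze_cvgr _ _ _ _ (fun n => - (M ^+ 2 * b (s_ n) (r / 4)))
      (fun n => M ^+ 2 * b (s_ n) (r / 4))) => //.
      apply: nearW => n; rewrite -I1 -ler_norml; apply: far => y.
        rewrite oneB; have /andP[h0 h1] := f01 n y.
        by apply/andP; split; lra.
      move=> /lipxy[_ xy]; rewrite oneB; have [[_ _ h1] _] := hf n.
      by rewrite h1 ?subrr// /l_; have := d_sum n; lra.
    by rewrite -oppr0; exact: cvgN.
  have : (fun n => 1 - heat_integral p (s_ n) (f_ n) x) @ \oo --> 1 - W 0%N x.
    by apply: cvgB => //; exact: cvg_cst.
  move=> c1 c2; have e : 1 - W 0%N x = 0.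
    exact: (cvg_unique (@Rhausdorff R) c1 c2).
  by apply/esym/eqP; rewrite -subr_eq0 e.
- move=> xr; apply: (cvg_unique (@Rhausdorff R) lim).
  apply: (@squeeze_cvgr _ _ _ _ (fun n => - (M ^+ 2 * b (s_ n) (r / 4)))
      (fun n => M ^+ 2 * b (s_ n) (r / 4))) => //.
    apply: nearW => n; rewrite -ler_norml; apply: far => // y.
    move=> /lipxy[xy _]; have [[_ h0 _] _] := hf n.
    by apply: h0; rewrite /m_; have := d_sum n; lra.
  by rewrite -oppr0; exact: cvgN.
Qed.

End CutoffLimit.

(** * Sub-Gaussian bounds *)

Section SubGaussian.
Context {R : realType} (gamma1 gamma2 alpha beta : R).
Hypothesis g1_gt0 : 0 < gamma1.
Hypothesis g2_gt0 : 0 < gamma2.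
Hypothesis alpha_gt0 : 0 < alpha.
Hypothesis beta_gt1 : 1 < beta.
Implicit Types (t r : R).

Definition sub_gaussian t r : R := gamma1 / t `^ (alpha / beta) *
  expR (- (gamma2 * (r `^ beta / t) `^ (1 / (beta - 1)))).

Let a := alpha / beta.
Let q := 1 / (beta - 1).
Let beta_gt0 : 0 < beta. Proof. exact: lt_trans beta_gt1. Qed.
Let a_gt0 : 0 < a. Proof. exact: divr_gt0. Qed.
Let q_gt0 : 0 < q. Proof. by rewrite divr_gt0// subr_gt0. Qed.

Lemma sub_gaussian_ge0 t r : 0 <= sub_gaussian t r.
Proof. by rewrite mulr_ge0 ?expR_ge0// divr_ge0 ?powR_ge0// ltW. Qed.

Lemma sub_gaussian_anti t r r' : 0 < t -> 0 <= r <= r' ->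
  sub_gaussian t r' <= sub_gaussian t r.
Proof.
move=> t0 /andP[r0 rr]; rewrite /sub_gaussian -/a -/q.
have r'0 : 0 <= r' by exact: le_trans rr.
have ti0 : 0 <= t^-1 by rewrite invr_ge0 ltW.
have rb : r `^ beta / t <= r' `^ beta / t.
  apply: ler_wpM2r => //; apply: ge0_ler_powR => //; exact: ltW.
have rbq : (r `^ beta / t) `^ q <= (r' `^ beta / t) `^ q.
  apply: ge0_ler_powR => //; first exact: ltW.
    by rewrite nnegrE mulr_ge0// powR_ge0.
  by rewrite nnegrE mulr_ge0// powR_ge0.
apply: ler_wpM2l; first by rewrite divr_ge0 ?powR_ge0// ltW.
by rewrite ler_expR lerN2; apply: ler_wpM2l => //; exact: ltW.
Qed.

(** A power of t large enough to absorb the diagonal singularity. *)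
Lemma sub_gaussian_diag : exists m : nat, forall t, 0 < t < 1 ->
  sub_gaussian t 0 <= gamma1 * t ^- m.
Proof.
exists (Num.bound a) => t /andP[t0 t1].
have am := archi_boundP (ltW a_gt0).
rewrite /sub_gaussian -/a -/q -[leRHS]mulr1 ler_pM ?expR_ge0//.
- by rewrite divr_ge0 ?powR_ge0// ltW.
- rewrite ler_wpM2l ?(ltW g1_gt0)// -powR_mulrn ?(ltW t0)//.
  rewrite lef_pV2 ?posrE ?powR_gt0//.
  by apply: ger_powR; rewrite ?t0 ltW.
- by rewrite expR_le1 oppr_le0 mulr_ge0 ?powR_ge0// ltW.
Qed.

(** Off the diagonal the exponential beats every power of t; exp x >= x^n / n!
    with n (1 / (beta - 1)) >= alpha / beta + 1 leaves a factor t. *)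
Lemma sub_gaussian_off_diag r : 0 < r -> exists2 C : R, 0 <= C &
  forall t, 0 < t < 1 -> sub_gaussian t r <= C * t.
Proof.
move=> r0; pose n := (Num.bound ((a + 1) / q)).
have an : a + 1 <= q * n.+1%:R.
  rewrite mulrC -ler_pdivrMr//; apply: ltW.
  have := archi_boundP (x := (a + 1) / q); rewrite -/n => h.
  apply: (lt_trans (h _)); last by rewrite ltr_nat.
  by rewrite divr_ge0 ?(ltW q_gt0)// addr_ge0 ?ler01 ?ltW.
have c0 : 0 < gamma2 * (r `^ beta) `^ q by rewrite mulr_gt0 ?powR_gt0.
set c := gamma2 * _ in c0.
exists (gamma1 * (n.+1`!%:R / c ^+ n.+1)) => [|t /andP[t0 t1]].
  by rewrite mulr_ge0 ?divr_ge0 ?exprn_ge0// ltW.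
rewrite /sub_gaussian -/a -/q -!mulrA ler_wpM2l ?(ltW g1_gt0)//.
have e : gamma2 * (r `^ beta / t) `^ q = c / t `^ q.
  have ti : t^-1 `^ q = (t `^ q)^-1.
    by rewrite -(powR_inv1 (ltW t0)) -powRrM mulN1r powRN.
  by rewrite powRM ?powR_ge0 ?invr_ge0 ?(ltW t0)// ti mulrA.
rewrite e; set x := c / t `^ q.
have tq : 0 < t `^ q by exact: powR_gt0.
have x0 : 0 < x by rewrite divr_gt0.
have xn : x ^+ n.+1 / n.+1`!%:R <= expR x.
  by apply: le_trans (expR_ge1Dxn n (ltW x0)); rewrite lerDr.
have f0 : 0 < n.+1`!%:R :> R by rewrite ltr0n fact_gt0.
have xb : expR (- x) <= n.+1`!%:R / x ^+ n.+1.
  by rewrite expRN -[leRHS]invf_div lef_pV2 ?posrE ?expR_gt0 ?divr_gt0 ?exprn_gt0.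
apply: (@le_trans _ _ ((t `^ a)^-1 * (n.+1`!%:R / x ^+ n.+1))).
  by rewrite ler_wpM2l// invr_ge0 powR_ge0.
have -> : x ^+ n.+1 = c ^+ n.+1 / t `^ (q * n.+1%:R).
  by rewrite /x exprMn exprVn (powRrM t q n.+1%:R) powR_mulrn// powR_ge0.
have -> : (t `^ a)^-1 * (n.+1`!%:R / (c ^+ n.+1 / t `^ (q * n.+1%:R)))
    = n.+1`!%:R / c ^+ n.+1 * ((t `^ a)^-1 * t `^ (q * n.+1%:R)).
  by rewrite invfM invrK; ring.
rewrite [leRHS]mulrA; apply: ler_wpM2l.
  by rewrite divr_ge0 ?exprn_ge0// ltW.
rewrite -powRN -powRD; last by rewrite (gt_eqF t0) implybT.
rewrite -[leRHS](powRr1 (ltW t0)); apply: ger_powR; first by rewrite t0 ltW.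
by have := an; lra.
Qed.

End SubGaussian.

(** * Smooth bump functions *)

(** In a metric space the distance to the complement of [U°] is positive on the
    compact set K, hence bounded below by some r on K; then r minus this
    distance separates K from the complement of U. *)
Lemma lipschitz_separation {R : realType} {X : pmetricType R} (K U : set X) :
  compact K -> K `<=` U° -> exists (delta : X -> R) (r : R),
  [/\ 0 < r, forall x y, `|delta x - delta y| <= mdist x y,
      forall x, K x -> delta x <= 0 & forall x, ~ U° x -> r <= delta x].
Proof.
move=> cK KU.
have [[z0 Uz0]|noU] := pselect (exists z, ~ U° z); last first.
  exists (cst 0), 1; split => // [x y|x Ux]; first by rewrite subrr normr0 mdist_ge0.
  by case: noU; exists x.
have [[y0 Ky0]|noK] := pselect (exists y, K y); last first.
  exists (cst 1), 1; split => // [x y|x Kx]; first by rewrite subrr normr0 mdist_ge0.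
  by case: noK; exists x.
pose D x := [set mdist x z | z in ~` U°].
pose rho x := inf (D x).
have lbD x : has_lbound (D x) by exists 0 => _ [z _ <-]; exact: mdist_ge0.
have D0 x : D x !=set0 by exists (mdist x z0), z0.
have rho_le x z : ~ U° z -> rho x <= mdist x z.
  by move=> Uz; apply: ge_inf => //; exists z.
have rho_lip1 x y : rho x <= mdist x y + rho y.
  rewrite -lerBlDl; apply: lb_le_inf => // _ [z Uz <-].
  by rewrite lerBlDl (le_trans (rho_le x z Uz))// metric_triangle.
have rho_lip x y : `|rho x - rho y| <= mdist x y.
  have := rho_lip1 x y; have := rho_lip1 y x; rewrite (metric_sym y x) => *.
  by rewrite ler_norml; apply/andP; split; lra.
have crho := lipschitz_continuous rho_lip.
have [c cK' cmin] := compact_EVT_min (ex_intro _ y0 Ky0) cK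
  (@continuous_subspaceT _ _ K _ crho).
rewrite inE in cK'.
have /nbhs_ballP[e /= e0 eU] : nbhs c U° by apply: nbhs_interior; exact: KU.
have rc : 0 < rho c.
  apply: lt_le_trans e0 _; apply: lb_le_inf => // _ [z Uz <-].
  by rewrite leNgt; apply/negP => cz; apply: Uz; apply: eU; rewrite ballEmdist.
exists (fun x => rho c - rho x), (rho c); split => //.
- move=> x y; have -> : rho c - rho x - (rho c - rho y) = rho y - rho x by ring.
  by rewrite distrC.
- by move=> x Kx; rewrite subr_le0 cmin// inE.
- by move=> x Ux; have := rho_le x x Ux; rewrite mdistxx => *; lra.
Qed.

(** The values prescribed on the support, on K and off U agree where these
    closed sets meet, so that Tietze's theorem extends them. *)
Lemma support_extension {R : realType} {X : pmetricType R}
    (mu : {measure set (borel X) -> \bar R}) (K U : set X) (w : X -> R) :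
  compact K -> K `<=` U° -> continuous w ->
  (forall x, measure_support mu x ->
    [/\ 0 <= w x <= 1, K x -> w x = 1 & ~ U° x -> w x = 0]) ->
  exists v : X -> R, [/\ continuous v, forall x, 0 <= v x <= 1,
    forall x, K x -> v x = 1, forall x, ~ U° x -> v x = 0
    & forall x, measure_support mu x -> v x = w x].
Proof.
move=> cK KU cw wS; pose S := measure_support mu.
have clK : closed K by exact: (compact_closed (@metric_hausdorff _ X)).
have clU : closed (~` U°) by apply: open_closedC; exact: open_interior.
have clS : closed S := measure_support_closed.
pose g x := if x \in K then 1 else if x \in ~` U° then 0 else w x.
have gK x : K x -> g x = 1 by move=> Kx; rewrite /g mem_set.
have gU x : ~ U° x -> g x = 0.
  by move=> Ux; rewrite /g memNset ?mem_set// => /KU.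
have gS x : S x -> g x = w x.
  move=> Sx; have [_ w1 w0] := wS x Sx.
  have [Kx|Kx] := pselect (K x); first by rewrite gK// w1.
  have [Ux|Ux] := pselect (~ U° x); first by rewrite gU// w0.
  by rewrite /g memNset// memNset//.
have within (B : set X) (f : X -> R) : continuous f -> (forall x, B x -> g x = f x) ->
    {within B, continuous g}.
  move=> cf gf; apply: (@subspace_eq_continuous _ _ _ f).
    by move=> x; rewrite inE => Bx; apply/esym; exact: gf.
  exact: continuous_subspaceT.
have cg : {within S `|` K `|` ~` U°, continuous g}.
  apply: withinU_continuous => //; first exact: closedU.
    apply: withinU_continuous => //; first exact: (within _ w).
    by apply: (within _ (cst 1)) => //; exact: cst_continuous.
  by apply: (within _ (cst 0)) => //; exact: cst_continuous.
have clC : closed (S `|` K `|` ~` U°) by apply: closedU => //; exact: closedU.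
have gb x : (S `|` K `|` ~` U°) x -> `|g x| <= 1.
  move=> [[Sx|Kx]|Ux].
  - by rewrite gS//; have [/andP[w0 w1] _ _] := wS x Sx; rewrite ger0_norm.
  - by rewrite gK// normr1.
  - by rewrite gU// normr0.
have [h [hg ch hb]] :=
  continuous_bounded_extension (@pseudometric_normal R X) clC ltr01 cg gb.
have hC x : (S `|` K `|` ~` U°) x -> h x = g x by move=> Cx; rewrite -hg// inE.
exists (fun x => Num.max (h x) 0); split.
- by move=> x; exact: (cvg_comp _ _ (ch x) (@continuous_pos_part R (h x))).
- move=> x; rewrite le_max lexx orbT ge_max ler01 andbT.
  exact: le_trans (ler_norm _) (hb x).
- by move=> x Kx; rewrite hC ?gK ?max_l//; left; right.
- by move=> x Ux; rewrite hC ?gU ?max_l//; right.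
- move=> x Sx; rewrite hC ?gS//; last by left; left.
  by have [/andP[w0 _] _ _] := wS x Sx; rewrite max_l.
Qed.

Lemma eseries_bounded {R : realType} (u : nat -> R) :
  (forall j, (1 <= j)%N -> 0 <= u j) ->
  (\sum_(1 <= j <oo) (u j)%:E < +oo)%E ->
  exists B : R, forall n, \sum_(1 <= j < n) u j <= B.
Proof.
move=> u0 us; have us0 : (0 <= \sum_(1 <= j <oo) (u j)%:E)%E.
  by apply: nneseries_ge0 => j j1 _; rewrite lee_fin u0.
exists (fine (\sum_(1 <= j <oo) (u j)%:E)%E) => n.
rewrite -lee_fin fineK ?ge0_fin_numE// -sumEFin.
by apply: nneseries_lim_ge => j j1 _; rewrite lee_fin u0.
Qed.

(** The sequence t_j is entered late enough for the total remaining time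
    s_0 = a_0 + a_1 + a_2 + ... to be less than t0; the decay only improves. *)
Lemma decay_sequences {R : realType} {X : pmetricType R}
    {mu : {measure set (borel X) -> \bar R}} (P : R -> L2 mu -> L2 mu)
    (lambda t0 r : R) : 0 < t0 -> 0 < r -> decay_assumption P lambda ->
  exists a_ d_ s_ : nat -> R,
  [/\ forall n, 0 < a_ n,
      (forall n, 0 <= d_ n) /\ (forall n, \sum_(0 <= i < n) d_ i <= r),
      (forall n, s_ n = a_ n + s_ n.+1) /\ (forall n, 0 < s_ n < t0),
      s_ @ \oo --> (0 : R)
    & forall k, exists B : R, forall n,
      \sum_(0 <= i < n) (a_ i.+1 ^- k * heat_decay P (a_ i) (d_ i)) <= B].
Proof.
move=> t0_gt0 r0 [eps0 eps0_gt0 /(_ (Num.min (eps0 / 2) r))].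
have e0 : 0 < Num.min (eps0 / 2) r by rewrite lt_min r0 andbT divr_gt0.
have e1 : Num.min (eps0 / 2) r < eps0.
  by rewrite gt_min; apply/orP; left; lra.
have er : Num.min (eps0 / 2) r <= r by rewrite ge_min lexx orbT.
move: (Num.min _ _) e0 e1 er => eps e0 e1 er; rewrite e0 e1 => /(_ isT).
move=> [t [_ tb tsum tdecay]].
have tpos j : (1 <= j)%N -> 0 < t j by move=> /tb /andP[].
pose T n := \sum_(1 <= j < n.+1) t j.
have TS n : T n.+1 = T n + t n.+1 by rewrite /T big_nat_recr.
have ndT : nondecreasing_seq T.
  by apply/nondecreasing_seqP => n; rewrite TS lerDl ltW// tpos.
have [BT hBT] := eseries_bounded (fun j j1 => ltW (tpos j j1)) tsum.
have cT : cvg (T @ \oo).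
  by apply: nondecreasing_is_cvgn => //; exists BT => _ [n _ <-]; exact: hBT.
have Tle n : T n <= lim (T @ \oo) by exact: nondecreasing_cvgn_le.
have [N _ hN] : \forall n \near \oo, lim (T @ \oo) - T n < t0.
  have := cT => /cvgrPdist_lt /(_ t0 t0_gt0); apply: filterS => n.
  by apply: le_lt_trans; exact: ler_norm.
pose s n := lim (T @ \oo) - T (N + n)%N.
have srec n : s n = t (N + n).+1 + s n.+1 by rewrite /s addnS TS; ring.
have s0 n : 0 < s n.
  by rewrite srec ltr_pwDl ?tpos// /s subr_ge0.
exists (fun n => t (N + n).+1), (fun n => eps * 2 ^- (N + n).+1), s; split.
- by move=> n; exact: tpos.
- split=> n; first by rewrite mulr_ge0 ?(ltW e0)// invr_ge0 exprn_ge0.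
  apply: le_trans er.
  have -> : eps = eps * 1 by rewrite mulr1.
  apply: (@le_trans _ _ (eps * \sum_(0 <= i < n) (2 ^- i.+1 : R))).
    rewrite mulr_sumr; apply: ler_sum => i _; rewrite mulr1 ler_wpM2l ?(ltW e0)//.
    rewrite lef_pV2 ?posrE ?exprn_gt0//; apply: ler_weXn2l; first by rewrite ler1n.
    by rewrite ltnS leq_addl.
  rewrite ler_wpM2l ?(ltW e0)//.
  have -> : \sum_(0 <= i < n) (2 ^- i.+1 : R) = 1 - 2 ^- n.
    elim: n => [|n ih]; first by rewrite big_geq// expr0 invr1 subrr.
    by rewrite big_nat_recr//= ih exprS invfM; field; rewrite expf_neq0.
  by rewrite gerBl invr_ge0 exprn_ge0.
- split=> n; first exact: srec.
  by rewrite s0/=; apply: hN => /=; exact: leq_addr.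
- rewrite -(subrr (lim (T @ \oo))); apply: cvgB; first exact: cvg_cst.
  have -> : (fun n => T (N + n)%N) = (fun n => T (n + N)%N).
    by apply/funext => n; rewrite addnC.
  by rewrite (cvg_shiftn N T).
- move=> k; pose u j := t j.+1 ^- k * heat_decay P (t j) (eps * 2 ^- j).
  have u0 j : 0 <= u j.
    by rewrite mulr_ge0 ?sqrtr_ge0// invr_ge0 exprn_ge0// ltW// tpos.
  have [B hB] := eseries_bounded (fun j _ => u0 j) (tdecay k).
  exists B => n; apply: le_trans (hB (n + N.+1)%N).
  rewrite [leRHS](big_cat_nat (n := N.+1))//=; last exact: leq_addl.
  rewrite -{2}(add0n N.+1) big_addn addnK.
  apply: le_trans (_ : \sum_(0 <= i < n) u (i + N.+1)%N <= _).
    rewrite le_eqVlt; apply/orP; left; apply/eqP; apply: eq_bigr => i _.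
    rewrite /u (_ : (i + N.+1 = (N + i).+1)%N); last by rewrite addnC addSn.
    by rewrite /= (addnS N i).
  by rewrite lerDr; apply: sumr_ge0 => i _; exact: u0.
Qed.

(* The kernel bound is only assumed for small times: for all t > 0 it would
   contradict P_t 1 = 1 as t -> oo, unless mu = 0. *)
Theorem corollary2p9 (R : realType) (X : pmetricType R)
    (mu : {measure set (borel X) -> \bar R})
    (Delta : operator mu) (F : set (L2 mu)) (form : L2 mu -> L2 mu -> R)
    (E : proj_measure mu) (P : R -> L2 mu -> L2 mu)
    (lambda : R) (p : R -> X -> X -> R)
    (gamma1 gamma2 alpha beta t0 : R) :
  self_adjoint Delta ->
  dirichlet_form F form ->
  associated_operator F form Delta ->
  neumann Delta ->
  spectral_resolution Delta E ->
  heat_operators E P ->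
  markov_operators P ->
  0 < lambda ->
  spectrum Delta `<=` [set 0] `|` `[lambda, +oo[ ->
  decay_assumption P lambda ->
  continuous_heat_kernel P p ->
  0 < gamma1 -> 0 < gamma2 -> 0 < alpha -> 1 < beta -> 0 < t0 ->
  (forall (t : R) (x y : X), 0 < t < t0 ->
     p t x y <= gamma1 / t `^ (alpha / beta) *
       expR (- (gamma2 * (mdist x y `^ beta / t) `^ (1 / (beta - 1))))) ->
  (mu setT < +oo)%E ->
  forall K U : set X, compact K -> K `<=` U° ->
  exists v : X -> R, [/\ smooth Delta v,
    forall x, 0 <= v x,
    forall x, K x -> v x = 1
  & forall x, ~ U x -> v x = 0].
Proof.
move=> saD _ _ neumannD DE PE markovP _ _ decayP pP g1 g2 a0 b1 t00 pb muT K U cK KU.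
pose b := sub_gaussian gamma1 gamma2 alpha beta.
pose T0 := Num.min t0 1.
have T00 : 0 < T0 by rewrite lt_min t00 ltr01.
have T0P t : 0 < t < T0 -> 0 < t < t0 /\ 0 < t < 1.
  by move=> /andP[-> /=]; rewrite lt_min => /andP[-> ->].
have pb' (t : R) x y : 0 < t < T0 -> p t x y <= b t (mdist x y).
  by move=> /T0P[tt _]; exact: pb.
have b_ge0 (t r : R) : 0 < t < T0 -> 0 <= b t r.
  by move=> _; exact: sub_gaussian_ge0.
have b_anti (t r r' : R) : 0 < t < T0 -> 0 <= r <= r' -> b t r' <= b t r.
  by move=> /andP[tt _]; exact: sub_gaussian_anti.
have b_cvg (r : R) (t_ : nat -> R) : 0 < r -> (forall n, 0 < t_ n < T0) ->
    t_ @ \oo --> (0 : R) -> (fun n => b (t_ n) r) @ \oo --> (0 : R).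
  move=> r0 tt t_0; have [C C0 hC] := sub_gaussian_off_diag g1 g2 a0 b1 r0.
  apply: (@squeeze_cvgr _ _ _ _ (cst 0) (fun n => C * t_ n)).
  - by apply: nearW => n; rewrite b_ge0//=; apply: hC; have [] := T0P _ (tt n).
  - exact: cvg_cst.
  - by rewrite -(mulr0 C); exact: cvgMr.
have [m hm] := sub_gaussian_diag g1 g2 a0 b1.
have b_poly t : 0 < t < T0 -> b t 0 <= gamma1 * t ^- m by move=> /T0P[_]; exact: hm.
have [one oneE] : exists one : L2 mu, (one : X -> R) = cst 1.
  by apply: (bounded_L2 muT) => //; exists `|1|.
have D1 : Delta one 0.
  by apply: neumannD => //; rewrite oneE; exact: ae_eq_refl.
have [delta [r [r0 dlip dK dU]]] := lipschitz_separation cK KU.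
have r4 : 0 < r / 4 by rewrite divr_gt0.
have [a_ [d_ [s_ [a_0 [d_0 d_s] [s_r s_b] s_c dec]]]] :=
  decay_sequences T00 r4 decayP.
have [W [hW WS]] := cutoff_limit muT saD DE PE markovP oneE D1 T00 pP pb' b_ge0
  b_anti b_cvg b_poly dlip r0 a_0 d_0 d_s s_r s_b s_c dec.
have [cW _] := hW 0%N.
have [|v [cv v01 vK vU vS]] := @support_extension _ _ mu K U (W 0%N) cK KU cW.
  move=> x /WS[w01 w1 w0]; split => // [Kx|Ux]; first exact/w1/dK.
  exact/w0/dU.
exists v; split => //.
- split=> //; have [u uE] : exists u : L2 mu, (u : X -> R) = v.
    apply: (bounded_L2 muT); first exact: continuous_borel.
    by exists 1 => x; have /andP[v0 v1] := v01 x; rewrite ger0_norm.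
  exists u => // k; exists (W k); last exact: (hW k).1.
  apply: (iter_operator_ae saD _ (ae_eq_refl _ _ _) (hW k).2).
  apply: ae_mono (ae_support muT DE PE oneE D1 T00 pP pb' b_anti b_cvg) => x Sx _.
  by rewrite uE vS.
- by move=> x; have /andP[] := v01 x.
- by move=> x Ux; apply: vU => /interior_subset.
Qed.
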